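(* Let $K$ be a field, $R = K[x_1, x_2, x_3, x_4]$ with the standard grading, and $I = (x_1x_2x_3, x_1x_2x_4, x_1x_3x_4, x_2x_3x_4)$. Then, for $s \geq 3$, the minimal graded free resolution of $R/I^s$ is of the form \[ 0 \to R(-3s-3)^{\beta_4} \longrightarrow R(-3s-2)^{\beta_3} \longrightarrow R(-3s-1)^{\beta_2} \longrightarrow R(-3s)^{\beta_1} \longrightarrow R \to 0 \] where \[ \beta_1 = \binom{s+3}{3},\quad \beta_2 = 3\binom{s+2}{3},\quad \beta_3 = 3\binom{s+1}{3},\quad \text{and}\quad \beta_4 = \binom{s}{3}. \] In particular, $\operatorname{reg}_R (I^s)=3s$. Moreover, the Hilbert series of $R/I^s$ is given by \[ H(R/I^s,t) = \frac{1+2t+3t^2+4t^3+ \cdots +3st^{3s-1} - \left(\binom{s+3}{3}-3s-1 \right)t^{3s} + \binom{s}{3} t^{3s+1}}{(1-t)^2} = \frac{ \sum_{i=0}^{3s-1} (i+1)t^i + \left(3s+1 - \binom{s+3}{3}\right)t^{3s} + \binom{s}{3} t^{3s+1}}{(1-t)^2}. \]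
   Context: For a finitely generated graded $R$-module $M$, $\operatorname{reg}_R(M)=\max\{j-i : \operatorname{Tor}_i^R(M,K)_j\neq 0\}$ is the Castelnuovo-Mumford regularity, and $H(M,t)=\sum_{j}\dim_K(M_j)\,t^j$ is the Hilbert series. *)

(* Defs.v *)
From HB Require Import structures.
From mathcomp Require Import all_boot all_order all_algebra.
From mathcomp Require Import boolp.
From mathcomp.multinomials Require Import mpoly.

Set Implicit Arguments.
Unset Strict Implicit.
Unset Printing Implicit Defensive.

Import Order.TTheory GRing.Theory Num.Theory.
Local Open Scope ring_scope.

Section SubQuotient.
Variables (R : nzRingType) (V : lmodType R) (J : submodClosed V).

Record submodule := Submodule { sub_val :> V; _ : sub_val \in J }.
HB.instance Definition _ := [isSub for sub_val].
HB.instance Definition _ := [Choice of submodule by <:].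
HB.instance Definition _ := [SubChoice_isSubLmodule of submodule by <:].

(* Quotient.quot wants a subgroup; it only provides the additive structure, so
   the scaling on V / J is added below. *)
Fact submod_zmod : zmod_closed J.
Proof. exact: GRing.submod_closedB (submodClosedP J). Qed.
Definition subgroup_of : zmodClosed V :=
  HB.pack (GRing.SubmodClosed.sort J)
    (GRing.isZmodClosed.Build V (GRing.SubmodClosed.sort J) submod_zmod).

Definition quotmod := Quotient.quot subgroup_of.
HB.instance Definition _ := GRing.Zmodule.on quotmod.
Definition to_quot (x : V) : quotmod := (\pi_(Quotient.quot subgroup_of) x)%qT.

Lemma to_quot_eq x y : (to_quot x == to_quot y) = (x - y \in J).
Proof. by rewrite /to_quot -Quotient.idealrBE. Qed.

Lemma to_quotP (x : quotmod) : exists y, x = to_quot y.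
Proof.
by exists (generic_quotient.repr (x : Quotient.quot subgroup_of));
   rewrite /to_quot generic_quotient.reprK.
Qed.

Lemma to_quotD : {morph to_quot : x y / x + y}.
Proof. by move=> x y; rewrite /to_quot raddfD. Qed.

Definition quot_scale (a : R) (x : quotmod) : quotmod :=
  to_quot (a *: generic_quotient.repr (x : Quotient.quot subgroup_of)).

Lemma to_quotZ a x : to_quot (a *: x) = quot_scale a (to_quot x).
Proof.
apply/eqP; rewrite to_quot_eq -scalerBr rpredZ //.
by rewrite -to_quot_eq /to_quot generic_quotient.reprK.
Qed.

Fact quot_scaleA a b x :
  quot_scale a (quot_scale b x) = quot_scale (a * b) x.
Proof. by have [y ->] := to_quotP x; rewrite -!to_quotZ scalerA. Qed.
Fact quot_scale1 : left_id 1 quot_scale.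
Proof. by move=> x; have [y ->] := to_quotP x; rewrite -to_quotZ scale1r. Qed.
Fact quot_scaleDr : right_distributive quot_scale +%R.
Proof.
move=> a x x'; have [y ->] := to_quotP x; have [z ->] := to_quotP x'.
by rewrite -to_quotD -!to_quotZ scalerDr to_quotD.
Qed.
Fact quot_scaleDl x : {morph quot_scale^~ x : a b / a + b}.
Proof.
by move=> a b; have [y ->] := to_quotP x; rewrite -!to_quotZ scalerDl to_quotD.
Qed.
HB.instance Definition _ := GRing.Zmodule_isLmodule.Build R quotmod
  quot_scaleA quot_scale1 quot_scaleDr quot_scaleDl.

Fact to_quot_linear : linear to_quot.
Proof. by move=> a x y; rewrite to_quotD to_quotZ. Qed.
HB.instance Definition _ := GRing.isLinear.Build R V quotmod _ to_quot
  to_quot_linear.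

Lemma to_quot_eq0 x : (to_quot x == 0) = (x \in J).
Proof. by rewrite -(raddf0 to_quot) to_quot_eq subr0. Qed.
End SubQuotient.

Section Ideals.
Variable R : comNzRingType.

(* The ideal generated by a set; ideals of R are submodules of R^o. *)
Definition ideal_gen (S : R -> Prop) : {pred R^o} := fun p : R =>
  `[< exists r : seq (R * R),
        (forall cg, cg \in r -> S cg.2) /\ p = \sum_(cg <- r) cg.1 * cg.2 >].

Lemma ideal_genP S (p : R) :
  reflect (exists r : seq (R * R),
    (forall cg, cg \in r -> S cg.2) /\ p = \sum_(cg <- r) cg.1 * cg.2)
  (p \in ideal_gen S).
Proof. exact: asboolP. Qed.

Fact ideal_gen_submod S : submod_closed (ideal_gen S).
Proof.
split.
  by apply/ideal_genP; exists [::]; rewrite big_nil.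
move=> a p q /ideal_genP[r [Sr ->]] /ideal_genP[t [St ->]]; apply/ideal_genP.
exists ([seq (a * cg.1, cg.2) | cg <- r] ++ t); split.
  move=> cg; rewrite mem_cat => /orP[/mapP[cg' cgr ->]|/St//].
  exact: Sr cgr.
rewrite big_cat big_map /=; congr (_ + _).
by rewrite [LHS]mulr_sumr; apply: eq_bigr => cg _; rewrite mulrA.
Qed.
HB.instance Definition _ S :=
  GRing.isSubmodClosed.Build R R^o (ideal_gen S) (ideal_gen_submod S).

Definition ideal_mul (I J : {pred R^o}) : {pred R^o} :=
  ideal_gen (fun p => exists a b : R, [/\ a \in I, b \in J & p = a * b]).
HB.instance Definition _ I J := GRing.SubmodClosed.on (ideal_mul I J).

End Ideals.

Section Graded.
Variables (K : fieldType) (n : nat).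
Local Notation R := {mpoly K[n]}.

(* p is homogeneous of degree j in Z: R_j = 0 for j < 0. *)
Definition homogz (j : int) (p : R) : bool :=
  if j is Posz d then p \is d.-homog else p == 0.

Record homogIdeal := HomogIdeal {
  hideal :> submodClosed R^o;
  hidealP : forall d (p : R), p \in hideal -> pihomog mdeg d p \in hideal
}.

Lemma homog_mul_component (J : submodClosed R^o) (c g : R) e d :
  g \is e.-homog -> g \in J -> pihomog mdeg d (c * g) \in J.
Proof.
move=> hg Jg; rewrite (pihomog_partitionE (mf := mdeg) (leqnn _ : (mmeasure mdeg c <= _)%N)).
rewrite mulr_suml raddf_sum; apply: (rpred_sum (S := J)) => i _.
have hc : pihomog mdeg i c * g \is (i + e).-homog.
  by apply: dhomogM => //; apply: pihomogP.
have Jc : pihomog mdeg i c * g \in J by exact: (@rpredZ _ _ J _ g Jg).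
rewrite /=; have [<-|ne] := eqVneq (i + e)%N d; first by rewrite (pihomog_dE hc).
rewrite (pihomog_ne0 ne hc); exact: (@rpred0 _ J).
Qed.

Lemma ideal_gen_homog (S : R -> Prop) :
  (forall g, S g -> exists e : nat, g \is e.-homog) ->
  forall d (p : R), p \in ideal_gen S -> pihomog mdeg d p \in ideal_gen S.
Proof.
move=> hS d _ /ideal_genP[r [Sr ->]].
rewrite raddf_sum big_seq.
apply: (rpred_sum (S := ideal_gen S)) => -[c g] /Sr /= Sg.
have [e hg] := hS g Sg; apply: homog_mul_component hg _.
by apply/ideal_genP; exists [:: (1, g)]; rewrite big_seq1 mul1r; split=> // cg;
   rewrite inE => /eqP->.
Qed.

Lemma ideal_mul_homog (I J : homogIdeal) d (p : R) :
  p \in ideal_mul I J -> pihomog mdeg d p \in ideal_mul I J.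
Proof.
move=> /ideal_genP[r [Sr ->]].
rewrite raddf_sum big_seq.
apply: (rpred_sum (S := ideal_mul I J)) => -[c g] /Sr /= [a [b [Ia Jb ->]]].
rewrite (pihomog_partitionE (mf := mdeg) (leqnn _ : (mmeasure mdeg a <= _)%N)).
rewrite mulr_suml mulr_sumr raddf_sum; apply: (rpred_sum (S := ideal_mul I J)) => i _.
rewrite (pihomog_partitionE (mf := mdeg) (leqnn _ : (mmeasure mdeg b <= _)%N)).
rewrite !mulr_sumr raddf_sum; apply: (rpred_sum (S := ideal_mul I J)) => j _.
apply: (@homog_mul_component _ _ _ (i + j)%N).
  by apply: dhomogM; apply: pihomogP.
set u := pihomog mdeg i a; set v := pihomog mdeg j b.
apply/ideal_genP; exists [:: (1, u * v)]; rewrite big_seq1 mul1r.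
split=> // cg; rewrite inE => /eqP->; exists u, v.
by split=> //; apply: hidealP.
Qed.

Definition hideal_gen (S : R -> Prop)
    (hS : forall g, S g -> exists e : nat, g \is e.-homog) : homogIdeal :=
  HomogIdeal (ideal_gen_homog hS).

Definition hideal_mul (I J : homogIdeal) : homogIdeal :=
  HomogIdeal (@ideal_mul_homog I J).

Fact unit_homog (g : R) : g = 1 -> exists e : nat, g \is e.-homog.
Proof. by move=> ->; exists 0%N; apply: dhomog1. Qed.

(* I ^ s, with I ^ 0 = (1) = R. *)
Definition hideal_exp (I : homogIdeal) (s : nat) : homogIdeal :=
  iter s (hideal_mul I) (hideal_gen unit_homog).

(* M = \bigoplus_j D j is a decomposition into additive subgroups such that
   R_i (D j) \subset D (i + j). *)
Record is_grading (M : lmodType R) (D : int -> M -> Prop) : Prop := IsGrading {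
  grading_zmod : forall j, D j 0 /\ forall x y, D j x -> D j y -> D j (x - y);
  grading_scale : forall i j (p : R) x,
    homogz i p -> D j x -> D (i + j) (p *: x);
  grading_sum : forall x, exists (r : seq int) (f : int -> M),
    (forall j, D j (f j)) /\ x = \sum_(j <- r) f j;
  grading_direct : forall (r : seq int) (f : int -> M),
    uniq r -> (forall j, D j (f j)) -> \sum_(j <- r) f j = 0 ->
    forall j, j \in r -> f j = 0
}.

Record gradedModule := GradedModule {
  gm_sort :> lmodType R;
  gm_piece : int -> gm_sort -> Prop;
  gm_grading : is_grading gm_piece
}.

Section IdealModules.
Variable J : homogIdeal.

Let proj (j : int) (p : R) : R := if j is Posz d then pihomog mdeg d p else 0.

Let projP j p : homogz j (proj j p).
Proof. by case: j => [d|d] /=; [exact: pihomogP | exact: eqxx]. Qed.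

Let projJ j p : p \in J -> proj j p \in J.
Proof. by case: j => d Jp /=; [exact: hidealP | exact: rpred0]. Qed.

Let proj_sum p : p = \sum_(j <- map Posz (iota 0 (mmeasure mdeg p))) proj j p.
Proof.
rewrite big_map [LHS](pihomog_partitionE (mf := mdeg) (leqnn _)).
by rewrite -(big_mkord xpredT (fun d => pihomog mdeg d p)) /index_iota subn0.
Qed.

Let projD j : {morph proj j : p q / p + q}.
Proof. by case: j => d p q /=; [exact: raddfD | rewrite addr0]. Qed.

Let proj0 j : proj j 0 = 0.
Proof. by case: j => d //=; exact: raddf0. Qed.

Let proj_homog i j p : homogz i p -> proj j p = if i == j then p else 0.
Proof.
case: i j => [d|d] [e|e] //=; last 1 [idtac] || idtac.
- move=> hp; have [<-|ne] := eqVneq d e; first by rewrite pihomog_dE ?eqxx.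
  by rewrite (pihomog_ne0 ne hp) eqz_nat (negPf ne).
- by move=> /eqP->; rewrite raddf0.
- by move=> /eqP->; rewrite if_same.
Qed.

Let homogzB j p q : homogz j p -> homogz j q -> homogz j (p - q).
Proof.
by case: j => d /=; [exact: rpredB | move=> /eqP-> /eqP->; rewrite subr0].
Qed.

Let homogz0 j : homogz j 0.
Proof. by case: j => d /=; [exact: rpred0 | exact: eqxx]. Qed.

Let homogzM i j p q : homogz i p -> homogz j q -> homogz (i + j) (p * q).
Proof.
case: i => d; last by move=> /eqP-> _; rewrite mul0r homogz0.
case: j => e; last by move=> _ /eqP->; rewrite mulr0 homogz0.
exact: dhomogM.
Qed.

Let proj_bigsum (r : seq int) (f : int -> R) i : uniq r ->
  (forall j, homogz j (f j)) -> i \in r -> proj i (\sum_(j <- r) f j) = f i.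
Proof.
move=> ur hf ir; rewrite (big_morph (proj i) (projD i) (proj0 i)).
rewrite (bigD1_seq i) //= (proj_homog i (hf i)) eqxx big1 ?addr0 // => j ne.
by rewrite (proj_homog i (hf j)) (negPf ne).
Qed.

Definition ideal_piece (j : int) (x : submodule J) : Prop := homogz j (val x).

Fact ideal_grading : is_grading ideal_piece.
Proof.
split.
- move=> j; split; first exact: homogz0.
  by move=> x y; exact: homogzB.
- by move=> i j p x; exact: homogzM.
- move=> x; exists (map Posz (iota 0 (mmeasure mdeg (val x)))).
  exists (fun j => Submodule (projJ j (valP x))); split.
    by move=> j; exact: projP.
  by apply: val_inj; rewrite raddf_sum; exact: proj_sum.
- move=> r f ur hf f0 i ir; apply: val_inj.
  have s0 : \sum_(j <- r) (val (f j) : R) = 0.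
    by have := congr1 val f0; rewrite raddf_sum.
  by have := proj_bigsum ur hf ir; rewrite s0 proj0.
Qed.

Definition quot_piece (j : int) (x : quotmod J) : Prop :=
  exists2 p : R, homogz j p & x = to_quot J p.

Fact quot_grading : is_grading quot_piece.
Proof.
split.
- move=> j; split; first by exists 0; rewrite ?homogz0 // raddf0.
  move=> _ _ [p hp ->] [q hq ->]; exists (p - q); first exact: homogzB.
  by rewrite raddfB.
- move=> i j p _ hp [q hq ->]; exists (p * q); first exact: homogzM.
  by rewrite -[p * q]/(p *: (q : R^o)) to_quotZ.
- move=> x; have [p ->] := to_quotP x.
  exists (map Posz (iota 0 (mmeasure mdeg (p : R)))).
  exists (fun j => to_quot J (proj j p)); split.
    by move=> j; exists (proj j p); rewrite ?projP.
  by rewrite -raddf_sum -proj_sum.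
- move=> r f ur hf f0 i ir.
  have [|g hg] :=
      @choice int R (fun j p => homogz j p /\ f j = to_quot J p).
    by move=> j; have [p hp fp] := hf j; exists p.
  have Jg : to_quot J (\sum_(j <- r) g j) == 0.
    apply/eqP; rewrite -[RHS]f0 raddf_sum.
    by apply: eq_bigr => j _; rewrite (hg j).2.
  rewrite to_quot_eq0 in Jg.
  rewrite (hg i).2; apply/eqP; rewrite to_quot_eq0.
  rewrite -(proj_bigsum ur (fun j => (hg j).1) ir); exact: projJ.
Qed.

Definition ideal_module : gradedModule := GradedModule ideal_grading.
Definition quotient_module : gradedModule := GradedModule quot_grading.

End IdealModules.

(* A sequence of finitely generated graded free modules
   F_i = \bigoplus_a R(- shift i a) and R-linear maps F_{i+1} -> F_i, written
   as matrices acting on row vectors from the right. *)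
Record freeSeq := FreeSeq {
  frank : nat -> nat;
  fshift : forall i, 'I_(frank i) -> int;
  fdiff : forall i, 'M[R]_(frank i.+1, frank i)
}.

(* ... -> F_2 -> F_1 -> F_0 -> M -> 0 is exact, with maps of degree 0. *)
Record is_resolution (F : freeSeq) (M : gradedModule) : Prop := IsResolution {
  res_diff_homog : forall i a b,
    homogz (fshift (i := i.+1) a - fshift (i := i) b) (fdiff F i a b);
  res_exact : forall i (v : 'rV[R]_(frank F i.+1)),
    v *m fdiff F i = 0 <-> exists w, v = w *m fdiff F i.+1;
  res_augmentation : exists eps : {linear 'rV[R]_(frank F 0) -> M},
    [/\ forall a, gm_piece (fshift (i := 0) a) (eps (delta_mx 0 a)),
        forall x : M, exists v, x = eps v
      & forall v, eps v = 0 <-> exists w, v = w *m fdiff F 0]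
}.

(* F_{i+1} is mapped into (x_1, ..., x_n) F_i. *)
Definition minimal (F : freeSeq) : Prop :=
  forall i a b, (fdiff F i a b)@_0%MM = 0.

Definition is_minimal_resolution F M := is_resolution F M /\ minimal F.

(* F_i = R(-a)^b *)
Definition free_term (F : freeSeq) (i : nat) (b : nat) (a : int) : Prop :=
  frank F i = b /\ forall k, fshift (f := F) (i := i) k = a.

(* The differential of F (x)_R K, where K = R / (x_1, ..., x_n): the class of a
   polynomial is its constant coefficient. *)
Definition fibre_diff (F : freeSeq) (i : nat) :
    'M[K]_(frank F i.+1, frank F i) :=
  map_mx (mcoeff 0%MM) (fdiff F i).

Definition fibre_piece (F : freeSeq) (i : nat) (j : int)
    (v : 'rV[K]_(frank F i)) : Prop :=
  forall a, v 0 a != 0 -> fshift a = j.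

Definition fibre_cycle (F : freeSeq) (i : nat) : 'rV[K]_(frank F i) -> Prop :=
  if i is i'.+1 then fun v => v *m fibre_diff F i' = 0 else fun _ => True.

(* Tor_i^R(M, K)_j = H_i(F (x)_R K)_j for a graded free resolution F of M; up to
   isomorphism it does not depend on F. *)
Definition tor_neq0 (M : gradedModule) (i : nat) (j : int) : Prop :=
  exists F : freeSeq, is_resolution F M /\
    exists v : 'rV[K]_(frank F i),
      [/\ fibre_piece j v, fibre_cycle v
        & ~ exists w, fibre_piece j w /\ v = w *m fibre_diff F i].

Definition has_regularity (M : gradedModule) (r : int) : Prop :=
  (exists i j, tor_neq0 M i j /\ j - i%:Z = r) /\
  (forall i j, tor_neq0 M i j -> j - i%:Z <= r).

(* K acts on M through the constant polynomials. *)
Definition has_dim (M : lmodType R) (D : M -> Prop) (d : nat) : Prop :=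
  exists b : 'I_d -> M, (forall k, D (b k)) /\
    forall x, D x -> exists! c : 'rV[K]_d, x = \sum_k (c 0 k)%:MP *: b k.

End Graded.

(* Power series in Z[[t]] are coefficient sequences. *)
Definition pseries := nat -> int.
Definition pseries_of_poly (p : {poly int}) : pseries := fun m => p`_m.
Definition pseries_mul (f g : pseries) : pseries :=
  fun m => \sum_(i < m.+1) f i * g (m - i)%N.

(* H = p / q in Z[[t]]; meaningful for q(0) = 1. *)
Definition pseries_eq_frac (H : pseries) (p q : {poly int}) : Prop :=
  pseries_mul H (pseries_of_poly q) =1 pseries_of_poly p.

(* Only for M concentrated in degrees >= 0; otherwise the Hilbert series is a
   Laurent series. *)
Definition is_hilbert_series (K : fieldType) (n : nat) (M : gradedModule K n)
    (H : pseries) : Prop :=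
  (forall j (x : M), j < 0 -> gm_piece j x -> x = 0) /\
  (forall j : nat, exists2 d : nat, has_dim (gm_piece (g := M) j) d & H j = d).

Section TheIdeal.
Variable K : fieldType.
Local Notation R := {mpoly K[4]}.

Definition x1 : R := 'X_(inord 0).
Definition x2 : R := 'X_(inord 1).
Definition x3 : R := 'X_(inord 2).
Definition x4 : R := 'X_(inord 3).

Definition gens : seq R :=
  [:: x1 * x2 * x3; x1 * x2 * x4; x1 * x3 * x4; x2 * x3 * x4].

Fact gens_homog (g : R) : g \in gens -> exists e : nat, g \is e.-homog.
Proof.
have h (i : 'I_4) : ('X_i : R) \is 1.-homog by rewrite dhomogX; apply/eqP/mdeg1.
rewrite !inE => /or4P[] /eqP->; exists (1 + 1 + 1)%N;
  by apply: dhomogM; [apply: dhomogM |]; exact: h.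
Qed.

Definition squarefree3_ideal : homogIdeal K 4 := hideal_gen gens_homog.

End TheIdeal.

(* Main.v *)
(** The Rees algebra of [I] is [A / (f_1, f_2, f_3)] with [A = R[T_1, ..., T_4]]
    and [f_i = x_i T_i - x_4 T_4], where [T_i] is mapped to [x_1 x_2 x_3 x_4 / x_i].
    The leading terms [x_i T_i] are pairwise coprime: division by [f_i] is an
    additive operator on [A] commuting with multiplication by the other [f_j], so
    the Koszul complex of [f_1, f_2, f_3] is exact. Its strand of T-degree [s] is a
    linear resolution of [I^s], with ranks given by the numbers of monomials in
    [T_1, ..., T_4] of degrees [s], [s-1], [s-2], [s-3]. Any two resolutions are
    homotopy equivalent, which gives uniqueness of the minimal one and the
    regularity. For the Hilbert series, the monomials of [I^s] in degree [3s + a]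
    correspond to pairs of monomials of degrees [a] and [s] in [x] and [T] not
    divisible by [x_i T_i] for [i < 4], which are counted by inclusion-exclusion. *)

From HB Require Import structures.
Require Import Defs.
From mathcomp Require Import all_boot all_order all_algebra.
From mathcomp Require Import boolp zify ring.
From mathcomp.multinomials Require Import mpoly.
Import Order.TTheory GRing.Theory Num.Theory.
Local Open Scope ring_scope.

Set Implicit Arguments.
Unset Strict Implicit.
Unset Printing Implicit Defensive.

(** * Comparison of graded free resolutions *)

Section HomogeneousComponents.
Variables (K : fieldType) (n : nat).
Local Notation S := {mpoly K[n]}.

(** One explicit resolution does not suffice: [tor_neq0] ranges over all graded free resolutions and
    the claim on Betti numbers over all minimal ones. Homogeneous chain maps and homotopies are
    therefore built between arbitrary resolutions, although a graded module comes only with its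
    pieces and no projections onto them. Division by u - v, with u = x_i T_i and v = x_l T_l,
    replaces u by v in a monomial as often as possible. It leaves the exponents of the other x_j and
    T_j untouched, which is why it commutes with the other relations. It is not A-linear, but such
    operators still solve a Koszul relation for one coefficient after the other. Koszul exactness
    says nothing about the kernel of the map from A to R. That the relations generate this kernel in
    each T-degree comes from a normal form: modulo them, a monomial is determined by its T-degree
    and its image. The same normal form, read as a bijection, underlies the count for the Hilbert
    series. *)

Lemma homogzP j (p : S) :
  reflect (forall m, p@_m != 0 -> (mdeg m)%:Z = j) (homogz j p).
Proof.
case: j => d /=.
  apply: (iffP (dhomogP _ _ _)) => h m; last by rewrite mcoeff_msupp => /h [].
  by rewrite -mcoeff_msupp => /h ->.
apply: (iffP eqP) => [-> m|h]; first by rewrite mcoeff0 eqxx.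
apply/mpolyP => m; rewrite mcoeff0; apply/eqP/negPn/negP => /h.
by case.
Qed.

Lemma homogz0 j : homogz j (0 : S).
Proof. by apply/homogzP => m; rewrite mcoeff0 eqxx. Qed.

Lemma homogzN j (p : S) : homogz j p -> homogz j (- p).
Proof.
by move=> /homogzP h; apply/homogzP => m; rewrite mcoeffN oppr_eq0; exact: h.
Qed.

Lemma homogzD j (p q : S) : homogz j p -> homogz j q -> homogz j (p + q).
Proof.
move=> /homogzP hp /homogzP hq; apply/homogzP => m; rewrite mcoeffD => h.
have [e|/hp//] := eqVneq p@_m 0; apply: hq.
by rewrite e add0r in h.
Qed.

Lemma homogz_sum j (I : Type) (r : seq I) (P : pred I) (F : I -> S) :
  (forall i, P i -> homogz j (F i)) -> homogz j (\sum_(i <- r | P i) F i).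
Proof.
by move=> h; apply: (big_ind (fun p => homogz j p)) => //;
  [exact: homogz0 | exact: homogzD].
Qed.

Lemma homogzM i j (p q : S) :
  homogz i p -> homogz j q -> homogz (i + j) (p * q).
Proof.
case: i => d; last by move=> /eqP-> _; rewrite mul0r homogz0.
case: j => e; last by move=> _ /eqP->; rewrite mulr0 homogz0.
exact: dhomogM.
Qed.

Lemma homogz_coef0 j (p : S) : homogz j p -> p@_0%MM != 0 -> j = 0.
Proof. by move=> /homogzP h /h <-; rewrite mdeg0. Qed.

(** Indexed by all integers, because the degree [j - b k] of an entry in a shifted free module may
    be negative. *)
Definition hproj (j : int) (p : S) : S :=
  if j is Posz d then pihomog mdeg d p else 0.

Lemma hproj_is_additive j : additive (hproj j).
Proof. by case: j => d p q /=; rewrite ?subr0 ?raddfB. Qed.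

HB.instance Definition _ j :=
  GRing.isZmodMorphism.Build S S (hproj j) (hproj_is_additive j).

Lemma hprojP j p : homogz j (hproj j p).
Proof. by case: j => d /=; [exact: pihomogP | exact: eqxx]. Qed.

Lemma hproj_homog i j p :
  homogz i p -> hproj j p = if i == j then p else 0.
Proof.
case: i j => [d|d] [e|e] //=.
- move=> hp; have [<-|ne] := eqVneq d e; first by rewrite pihomog_dE ?eqxx.
  by rewrite (pihomog_ne0 ne hp) eqz_nat (negPf ne).
- by move=> /eqP->; rewrite raddf0.
- by move=> /eqP->; rewrite if_same.
Qed.

Lemma hproj_sum (p : S) k : (msize p <= k)%N ->
  p = \sum_(d < k) hproj d p.
Proof. by move=> hk; exact: (pihomog_partitionE (mf := mdeg)). Qed.

Arguments hproj : simpl never.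

(** The product of [g] with the component of [p] of degree [d] has degree [d + e], so only [d = i]
    survives the projection. *)
Lemma hprojM (i e : int) (p g : S) : homogz e g ->
  hproj (i + e) (p * g) = hproj i p * g.
Proof.
move=> hg; rewrite [in LHS](hproj_sum (leqnn (msize p))) mulr_suml raddf_sum.
rewrite [in RHS](hproj_sum (leqnn (msize p))) raddf_sum mulr_suml.
apply: eq_bigr => d _.
rewrite /= (hproj_homog _ (homogzM (hprojP _ _) hg)) (hproj_homog _ (hprojP _ _)).
by rewrite (inj_eq (addIr e)); case: ifP; rewrite ?mul0r.
Qed.

End HomogeneousComponents.

Arguments hproj : simpl never.

(** * Chain maps, homotopies and uniqueness of minimal resolutions *)

Section Comparison.
Variables (K : fieldType) (n : nat).
Local Notation S := {mpoly K[n]}.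

(** The matrices of degree 0 maps from the sum of the S(-a i) to the sum of the S(-b j). *)
Definition homogmx p q (a : 'I_p -> int) (b : 'I_q -> int) (A : 'M[S]_(p, q)) :=
  forall i j, homogz (a i - b j) (A i j).

Lemma homogmxM p q r a b c (A : 'M[S]_(p, q)) (B : 'M_(q, r)) :
  homogmx a b A -> homogmx b c B -> homogmx a c (A *m B).
Proof.
move=> hA hB i k; rewrite mxE; apply: homogz_sum => j _.
have -> : a i - c k = (a i - b j) + (b j - c k) by ring.
exact: homogzM.
Qed.

Lemma homogmxB p q a b (A B : 'M[S]_(p, q)) :
  homogmx a b A -> homogmx a b B -> homogmx a b (A - B).
Proof.
by move=> hA hB i j; rewrite !mxE; apply: homogzD; rewrite ?homogzN.
Qed.

Lemma homogmx1 p (a : 'I_p -> int) : homogmx a a (1%:M : 'M[S]_p).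
Proof.
move=> i j; rewrite mxE; case: eqP => [->|_] /=; last exact: homogz0.
by rewrite subrr; exact: dhomog1.
Qed.

Definition hprojv q (b : 'I_q -> int) (j : int) (v : 'rV[S]_q) : 'rV[S]_q :=
  \row_k hproj (j - b k) (v 0 k).

Lemma hprojvM q r b c j (v : 'rV[S]_q) (D : 'M_(q, r)) :
  homogmx b c D -> hprojv b j v *m D = hprojv c j (v *m D).
Proof.
move=> hD; apply/rowP => k; rewrite !mxE raddf_sum; apply: eq_bigr => i _.
rewrite mxE -(hprojM _ _ (hD i k)); congr (hproj _ _).
by ring.
Qed.

(** A grading gives only the independence of its pieces; this replaces the projection of a sum of
    homogeneous elements onto degree [j]. *)
Lemma grading_piece_sum (M : lmodType S) (D : int -> M -> Prop) (I : finType)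
    (g : I -> int) (x : I -> M) j :
  is_grading D -> (forall i, D (g i) (x i)) -> D j (\sum_i x i) ->
  \sum_i x i = \sum_(i | g i == j) x i.
Proof.
move=> [hz _ _ hd] hx hj.
have D0 t : D t 0 := (hz t).1.
have DB t y z : D t y -> D t z -> D t (y - z) by case: (hz t) => _; exact.
have DD t y z : D t y -> D t z -> D t (y + z).
  by move=> hy hz'; rewrite -[z]opprK -[- z]sub0r; do 2 ?apply: (DB) => //.
pose r := undup (j :: [seq g i | i <- enum I]).
(* The terms of degree [t], minus the whole sum when [t = j]. These elements add up to 0, so [f j]
   vanishes by independence. *)
pose f t := \sum_(i | g i == t) x i - (if t == j then \sum_i x i else 0).
have hf t : D t (f t).
  apply: DB; last by case: eqP => [->|].
  by apply: (big_ind (D t)) => // [y z|i /eqP <-] //; exact: DD.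
have jr : j \in r by rewrite mem_undup inE eqxx.
have := hd r f (undup_uniq _) hf _ j jr.
rewrite /f eqxx => h; apply/esym/eqP; rewrite -subr_eq0; apply/eqP/h.
apply/eqP; rewrite sumrB subr_eq0; apply/eqP.
rewrite (exchange_big_dep xpredT) //=.
rewrite [RHS](bigD1_seq j) ?undup_uniq //= eqxx.
rewrite [X in _ = _ + X]big1 ?addr0; last by move=> i /negPf->.
apply: eq_bigr => i _.
rewrite big_mkcond /= (bigD1_seq (g i)) ?undup_uniq //=; last first.
  by rewrite mem_undup inE map_f ?orbT // mem_enum.
by rewrite eqxx big1 ?addr0 // => t /negPf; rewrite eq_sym => ->.
Qed.

(** The entries of [v] split into components, which makes [eps v] a sum of homogeneous elements;
    those of degree [j] come from [hprojv a j v]. Arbitrary preimages under an augmentation can thus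
    be made homogeneous. *)
Lemma augmentation_hprojv (M : gradedModule K n) p (a : 'I_p -> int)
    (eps : {linear 'rV[S]_p -> M}) j v :
  (forall i, gm_piece (a i) (eps (delta_mx 0 i))) ->
  gm_piece j (eps v) -> eps (hprojv a j v) = eps v.
Proof.
move=> heps; pose k := (\max_i msize (v 0%R i))%N.
have hk i : (msize (v 0%R i) <= k)%N by exact: (leq_bigmax i).
have hM := gm_grading M.
pose x (t : 'I_p * 'I_k) : M := hproj t.2 (v 0 t.1) *: eps (delta_mx 0 t.1).
pose g (t : 'I_p * 'I_k) : int := t.2%:Z + a t.1.
have hx t : gm_piece (g t) (x t).
  by apply: (grading_scale hM); [exact: hprojP | exact: heps].
have -> : eps v = \sum_t x t.
  rewrite -(pair_bigA _ (fun i d => x (i, d))) /= {1}[v]row_sum_delta linear_sum.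
  apply: eq_bigr => i _.
  by rewrite linearZ /= {1}(hproj_sum (hk i)) scaler_suml.
move=> hj; rewrite (grading_piece_sum hM hx hj).
rewrite big_mkcond -(pair_bigA _ (fun i d => if g (i, d) == j then x (i, d) else 0)).
rewrite [hprojv _ _ _]row_sum_delta linear_sum /=.
apply: eq_bigr => i _; rewrite linearZ /= mxE {1}(hproj_sum (hk i)).
rewrite raddf_sum scaler_suml; apply: eq_bigr => d _ /=.
rewrite (hproj_homog _ (hprojP _ _)) /g /x /= -(inj_eq (addIr (a i))) subrK.
by case: ifP => // _; rewrite scale0r.
Qed.

(** Arbitrary preimages of the rows are projected to the right degree; the projection commutes with
    [D] and fixes the rows of [E]. *)
Lemma lift_homogmx p q r (a : 'I_p -> int) (b : 'I_q -> int) (c : 'I_r -> int)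
    (E : 'M[S]_(p, r)) (D : 'M_(q, r)) :
  homogmx a c E -> homogmx b c D -> (forall i, exists w, row i E = w *m D) ->
  exists2 F : 'M_(p, q), homogmx a b F & F *m D = E.
Proof.
move=> hE hD /choice[w hw].
exists (\matrix_i hprojv b (a i) (w i)).
  by move=> i j; rewrite !mxE; exact: hprojP.
apply/row_matrixP => i; rewrite row_mul rowK (hprojvM _ _ hD) -hw.
apply/rowP => k; by rewrite !mxE (hproj_homog _ (hE i k)) eqxx.
Qed.

Lemma image_resolution (F : freeSeq K n) M (hF : is_resolution F M) i p
    (A : 'M[S]_(p, frank F i.+1)) :
  A *m fdiff F i = 0 -> forall k, exists w, row k A = w *m fdiff F i.+1.
Proof. by move=> hA k; apply/(res_exact hF); rewrite -row_mul hA row0. Qed.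

Lemma resolution_complex (F : freeSeq K n) M (hF : is_resolution F M) i :
  fdiff F i.+1 *m fdiff F i = 0.
Proof.
apply/row_matrixP => k; rewrite row0 row_mul; apply/(res_exact hF).
by exists (delta_mx 0 k); rewrite -rowE.
Qed.

Section TwoResolutions.
Variables (F G : freeSeq K n) (M : gradedModule K n).
Hypotheses (hF : is_resolution F M) (hG : is_resolution G M).
Variables (epsF : {linear 'rV[S]_(frank F 0) -> M})
  (epsG : {linear 'rV[S]_(frank G 0) -> M}).
Hypotheses
  (epsF_homog : forall a, gm_piece (fshift (i := 0) a) (epsF (delta_mx 0 a)))
  (epsF_ker : forall v, epsF v = 0 <-> exists w, v = w *m fdiff F 0)
  (epsG_homog : forall a, gm_piece (fshift (i := 0) a) (epsG (delta_mx 0 a)))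
  (epsG_onto : forall x : M, exists v, x = epsG v)
  (epsG_ker : forall v, epsG v = 0 <-> exists w, v = w *m fdiff G 0).

Definition is_chain_map (f : forall i, 'M[S]_(frank F i, frank G i)) :=
  [/\ forall i, homogmx (@fshift _ _ F i) (@fshift _ _ G i) (f i),
      forall v, epsG (v *m f 0%N) = epsF v
    & forall i, f i.+1 *m fdiff G i = fdiff F i *m f i].

Lemma chain_map_exists : exists f, is_chain_map f.
Proof.
pose cycF i (v : 'rV[S]_(frank F i)) := exists w, v = w *m fdiff F i.
pose cycG i (v : 'rV[S]_(frank G i)) := exists w, v = w *m fdiff G i.
(* The invariant of the recursion: boundaries go to boundaries, so the rows of [fdiff F i *m f] lift
   along [fdiff G i]. *)
pose ok i (f : 'M[S]_(frank F i, frank G i)) :=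
  homogmx (@fshift _ _ F i) (@fshift _ _ G i) f /\
  forall v, cycF i v -> cycG i (v *m f).
have [f0 [f0_homog f0_eps]] : exists f : 'M[S]_(frank F 0, frank G 0),
    homogmx (@fshift _ _ F 0) (@fshift _ _ G 0) f /\
    forall v, epsG (v *m f) = epsF v.
  have /choice[w hw] a := epsG_onto (epsF (delta_mx 0 a)).
  exists (\matrix_a hprojv (@fshift _ _ G 0) (@fshift _ _ F 0 a) (w a)); split.
    by move=> a b; rewrite !mxE; exact: hprojP.
  move=> v; rewrite mulmx_sum_row [v in RHS]row_sum_delta !linear_sum /=.
  apply: eq_bigr => a _; rewrite !linearZ /= rowK augmentation_hprojv ?hw //.
  by rewrite -hw; exact: epsF_homog.
have ok0 : ok 0%N f0.
  split=> // v hv; apply/epsG_ker; rewrite f0_eps; exact/epsF_ker.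
have step i (f : 'M[S]_(frank F i, frank G i)) : ok i f ->
    {g : 'M[S]_(frank F i.+1, frank G i.+1) |
      ok i.+1 g /\ g *m fdiff G i = fdiff F i *m f}.
  move=> [hf cf]; apply: cid.
  have [] := lift_homogmx (a := @fshift _ _ F i.+1) (b := @fshift _ _ G i.+1)
      (c := @fshift _ _ G i) (E := fdiff F i *m f) (D := fdiff G i).
  - by apply: homogmxM hf => k l; exact: (res_diff_homog hF).
  - by move=> k l; exact: (res_diff_homog hG).
  - by move=> k; rewrite row_mul; apply: cf; exists (delta_mx 0 k); rewrite -rowE.
  move=> g hg eg; exists g; split=> //; split=> // v /(res_exact hF) hv.
  by apply/(res_exact hG); rewrite -mulmxA eg mulmxA hv mul0mx.
(* Each map depends on the previous one and on the proof of its invariant, hence a recursion through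
   sigma types. *)
pose fix st i : {f | ok i f} :=
  if i is j.+1 then
    let: exist f hf := st j in let: exist g hg := step j f hf in exist _ g hg.1
  else exist _ f0 ok0.
exists (fun i => sval (st i)); split=> //.
- by move=> i; case: (svalP (st i)).
- by move=> i /=; case: (st i) => f hf /=; case: (step i f hf) => g [].
Qed.

End TwoResolutions.

Section NullHomotopy.
Variables (F : freeSeq K n) (M : gradedModule K n).
Hypothesis hF : is_resolution F M.
Variable phi : forall i, 'M[S]_(frank F i, frank F i).
Hypotheses
  (phi_homog : forall i, homogmx (@fshift _ _ F i) (@fshift _ _ F i) (phi i))
  (phi_0 : forall k, exists w, row k (phi 0%N) = w *m fdiff F 0)
  (phi_comm : forall i, phi i.+1 *m fdiff F i = fdiff F i *m phi i).

(** By [phi_comm], the second condition says that [fdiff F i] kills [phi i.+1 - fdiff F i *m h],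
    which is what the next homotopy has to lift. *)
Let homot i (h : 'M[S]_(frank F i, frank F i.+1)) :=
  homogmx (@fshift _ _ F i) (@fshift _ _ F i.+1) h /\
  fdiff F i *m (phi i - h *m fdiff F i) = 0.

(** The homotopy identity is used in one degree at a time, so the map [h'] from the degree below is
    only asserted to exist and no coherent family is chosen. *)
Let homotopy_eq i : 'M[S]_(frank F i, frank F i.+1) -> Prop :=
  if i is j.+1 then fun h =>
    exists h', phi j.+1 = fdiff F j *m h' + h *m fdiff F j.+1
  else fun h => phi 0%N = h *m fdiff F 0.

Let homotopy_exists i : exists2 h, homot (i := i) h & homotopy_eq h.
Proof.
elim: i => [|i [h [hh ch] _]].
  have [||//|h hh eh] := lift_homogmx (a := @fshift _ _ F 0)
    (b := @fshift _ _ F 1) (c := @fshift _ _ F 0) (E := phi 0) (D := fdiff F 0).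
  - exact: phi_homog.
  - by move=> k l; exact: (res_diff_homog hF).
  by exists h => //; split=> //; rewrite eh subrr mulmx0.
have [|||g hg eg] := lift_homogmx (a := @fshift _ _ F i.+1)
    (b := @fshift _ _ F i.+2) (c := @fshift _ _ F i.+1)
    (E := phi i.+1 - fdiff F i *m h) (D := fdiff F i.+1).
- apply: homogmxB => //; apply: homogmxM hh => k l; exact: (res_diff_homog hF).
- by move=> k l; exact: (res_diff_homog hF).
- apply: (image_resolution hF).
  by rewrite mulmxBl phi_comm -mulmxA -mulmxBr.
exists g; last by exists h; rewrite // eg addrC subrK.
split=> //; rewrite eg opprB addrC subrK mulmxA.
by rewrite (resolution_complex hF) mul0mx.
Qed.

(** On a cycle the summand of [phi i] that begins with a differential vanishes, and the other one
    gives the boundary of [v] times [h] over K. Constant coefficients of [h] are 0 unless the shifts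
    agree, so this element stays in degree [j]. *)
Lemma null_homotopic_fibre i j (v : 'rV[K]_(frank F i)) :
  fibre_piece j v -> fibre_cycle v ->
  exists w, fibre_piece j w /\
    v *m map_mx (mcoeff 0%MM) (phi i) = w *m fibre_diff F i.
Proof.
move=> hv cv; have [h [hh _] eh] := homotopy_exists i.
exists (v *m map_mx (mcoeff 0%MM) h); split.
  move=> b; rewrite mxE => nz.
  have [a ha] : exists a, v 0 a * (h a b)@_0%MM != 0.
    apply/existsP; apply: contraR nz; rewrite negb_exists => /forallP hz.
    rewrite big1 // => a _; apply/eqP; have := hz a.
    by rewrite negbK mxE.
  move: ha; rewrite mulf_eq0 negb_or => /andP[/hv <- /(homogz_coef0 (hh a b))/eqP].
  by rewrite subr_eq0 => /eqP.
case: i h hh eh v hv cv => [|i] h hh.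
  by move=> -> v _ _; rewrite /fibre_diff -mulmxA map_mxM.
move=> [h' ->] v _ cv; rewrite /fibre_diff map_mxD !map_mxM mulmxDr !mulmxA.
by move: cv; rewrite /= /fibre_diff => ->; rewrite mul0mx add0r.
Qed.

End NullHomotopy.

Section TorInvariance.
Variables (F G : freeSeq K n) (M : gradedModule K n).
Hypotheses (hF : is_resolution F M) (hG : is_resolution G M).

Lemma fibre_comparison :
  exists (f : forall i, 'M[K]_(frank F i, frank G i))
    (g : forall i, 'M[K]_(frank G i, frank F i)),
  [/\ forall i a b, f i a b != 0 ->
        fshift (f := F) (i := i) a = fshift (f := G) (i := i) b,
      forall i j (v : 'rV[K]_(frank F i)), fibre_piece j v -> fibre_cycle v ->
        exists w, fibre_piece j w /\ v *m f i *m g i - v = w *m fibre_diff F i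
    & forall i j (v : 'rV[K]_(frank G i)), fibre_piece j v -> fibre_cycle v ->
        exists w, fibre_piece j w /\ v *m g i *m f i - v = w *m fibre_diff G i].
Proof.
have [epsF [homF ontoF kerF]] := res_augmentation hF.
have [epsG [homG ontoG kerG]] := res_augmentation hG.
have [f [hf f0 fS]] := chain_map_exists hF hG homF kerF homG ontoG kerG.
have [g [hg g0 gS]] := chain_map_exists hG hF homG kerG homF ontoF kerF.
exists (fun i => map_mx (mcoeff 0%MM) (f i)).
exists (fun i => map_mx (mcoeff 0%MM) (g i)).
split.
- move=> i a b; rewrite mxE => /(homogz_coef0 (hf i a b))/eqP.
  by rewrite subr_eq0 => /eqP.
- move=> i j v hv cv.
  (* Both [f i *m g i] and the identity lift the identity of [M], so their difference induces 0 on
     [M]. *)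
  have [|||w [hw ew]] := null_homotopic_fibre hF (phi := fun i => f i *m g i - 1%:M)
    _ _ _ hv cv.
  + by move=> k; apply: homogmxB; [exact: homogmxM | exact: homogmx1].
  + move=> k; apply/kerF; rewrite rowE mulmxBr mulmx1 mulmxA raddfB /=.
    by rewrite g0 f0 subrr.
  + by move=> k; rewrite mulmxBl mulmxBr mul1mx mulmx1 -mulmxA gS !mulmxA fS.
  exists w; split=> //; rewrite -ew map_mxB map_mxM mulmxBr mulmxA.
  by rewrite map_mx1 mulmx1.
- move=> i j v hv cv.
  have [|||w [hw ew]] := null_homotopic_fibre hG (phi := fun i => g i *m f i - 1%:M)
    _ _ _ hv cv.
  + by move=> k; apply: homogmxB; [exact: homogmxM | exact: homogmx1].
  + move=> k; apply/kerG; rewrite rowE mulmxBr mulmx1 mulmxA raddfB /=.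
    by rewrite f0 g0 subrr.
  + by move=> k; rewrite mulmxBl mulmxBr mul1mx mulmx1 -mulmxA fS !mulmxA gS.
  exists w; split=> //; rewrite -ew map_mxB map_mxM mulmxBr mulmxA.
  by rewrite map_mx1 mulmx1.
Qed.

End TorInvariance.

Lemma minimal_fibre_diff (F : freeSeq K n) i : minimal F -> fibre_diff F i = 0.
Proof. by move=> h; apply/matrixP => a b; rewrite !mxE. Qed.

Lemma minimal_fibre_cycle (F : freeSeq K n) i (v : 'rV[K]_(frank F i)) :
  minimal F -> fibre_cycle v.
Proof. by case: i v => [|i] v h //=; rewrite minimal_fibre_diff ?mulmx0. Qed.

Lemma fibre_piece_delta (F : freeSeq K n) i (a : 'I_(frank F i)) :
  fibre_piece (fshift a) (delta_mx 0 a : 'rV[K]__).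
Proof. by move=> b; rewrite mxE /=; case: (b =P a) => [->|] //=; rewrite eqxx. Qed.

(** A class from any resolution is carried to [G]. If its image were 0, the homotopy would make it a
    boundary; a nonzero entry of the image points to a generator of degree [j]. *)
Lemma tor_neq0_shift (G : freeSeq K n) M i j :
  is_minimal_resolution G M -> tor_neq0 M i j ->
  exists b, fshift (f := G) (i := i) b = j.
Proof.
move=> [hG mG] [F [hF [v [hv cv bv]]]].
have [f [g [hf fg _]]] := fibre_comparison hF hG.
have [w [hw ew]] := fg i j v hv cv.
have [b nb] : exists b, (v *m f i) 0 b != 0.
  apply/existsP; apply: contra_notT bv; rewrite negb_exists => /forallP hz.
  exists (- w); split; first by move=> k; rewrite mxE oppr_eq0; exact: hw.
  rewrite mulNmx -ew (_ : v *m f i = 0) ?mul0mx ?sub0r ?opprK //.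
  by apply/rowP => k; rewrite [RHS]mxE; apply/eqP; rewrite -[_ == _]negbK.
exists b; move: nb; rewrite mxE => nb.
have [a] : exists a, v 0 a * f i a b != 0.
  apply/existsP; apply: contraR nb; rewrite negb_exists => /forallP hz.
  by rewrite big1 // => a _; apply/eqP/negPn/hz.
by rewrite mulf_eq0 negb_or => /andP[/hv <- /hf ->].
Qed.

Lemma minimal_tor_neq0 (F : freeSeq K n) M i (a : 'I_(frank F i)) :
  is_minimal_resolution F M -> tor_neq0 M i (fshift a).
Proof.
move=> [hF mF]; exists F; split=> //; exists (delta_mx 0 a); split.
- exact: fibre_piece_delta.
- exact: minimal_fibre_cycle.
move=> [w [_]]; rewrite minimal_fibre_diff // mulmx0 => /rowP /(_ a).
by rewrite !mxE !eqxx /= => /eqP; rewrite oner_eq0.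
Qed.

(** With zero fibre differentials, the comparison maps are mutually inverse matrices over K. Only
    the sets of shifts are compared, not multiplicities; this determines the shifts when, as below,
    each term of one resolution has a single shift. *)
Lemma minimal_resolution_unique (F G : freeSeq K n) M i :
  is_minimal_resolution F M -> is_minimal_resolution G M ->
  frank F i = frank G i /\
  forall a, exists b, fshift (f := F) (i := i) a = fshift (f := G) (i := i) b.
Proof.
move=> hF hG; split; last first.
  move=> a; have [b <-] := tor_neq0_shift hG (minimal_tor_neq0 a hF).
  by exists b.
have [f [g [_ fg gf]]] := fibre_comparison hF.1 hG.1.
apply/anti_leq/andP; split.
  apply: (@mulmx1_min K _ _ (f i) (g i)); apply/row_matrixP => a.
  have [||w [_]] := fg i (fshift (f := F) (i := i) a) (delta_mx 0 a).
  - exact: fibre_piece_delta.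
  - by apply: minimal_fibre_cycle; case: hF.
  rewrite (minimal_fibre_diff i hF.2) mulmx0 -mulmxA -!rowE => /eqP.
  by rewrite subr_eq0 => /eqP ->; rewrite rowE mulmx1.
apply: (@mulmx1_min K _ _ (g i) (f i)); apply/row_matrixP => a.
have [||w [_]] := gf i (fshift (f := G) (i := i) a) (delta_mx 0 a).
- exact: fibre_piece_delta.
- by apply: minimal_fibre_cycle; case: hG.
rewrite (minimal_fibre_diff i hG.2) mulmx0 -mulmxA -!rowE => /eqP.
by rewrite subr_eq0 => /eqP ->; rewrite rowE mulmx1.
Qed.

End Comparison.

(** * Koszul complexes and the Rees algebra *)

Section KoszulThree.
Variables (A : comNzRingType) (f1 f2 f3 : A) (Q1 Q2 Q3 : A -> A).
Hypotheses (Q1_0 : Q1 0 = 0) (Q2_0 : Q2 0 = 0) (Q3_0 : Q3 0 = 0).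
Hypotheses (Q1D : {morph Q1 : x y / x + y}) (Q2D : {morph Q2 : x y / x + y}).
Hypotheses (Q1f1 : forall p, Q1 (f1 * p) = p) (Q1f2 : forall p, Q1 (f2 * p) = f2 * Q1 p)
  (Q1f3 : forall p, Q1 (f3 * p) = f3 * Q1 p).
Hypotheses (Q2f2 : forall p, Q2 (f2 * p) = p) (Q2f3 : forall p, Q2 (f3 * p) = f3 * Q2 p).
Hypotheses (Q3f3 : forall p, Q3 (f3 * p) = p).

(** [Q1] solves the relation for [a1]. Substituting leaves a relation between [f2] and [f3], which
    [Q2] solves, and [Q3] then cancels [f3]. The witnesses are the quotients met on the way. *)
Lemma koszul_exact1 a1 a2 a3 : f1 * a1 + f2 * a2 + f3 * a3 = 0 ->
  exists b1 b2 b3, [/\ a1 = b2 * f3 - b3 * f2, a2 = b3 * f1 - b1 * f3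
    & a3 = b1 * f2 - b2 * f1].
Proof.
move=> e; have := congr1 Q1 e.
rewrite Q1_0 !Q1D Q1f1 Q1f2 Q1f3 => e1.
have ea1 : a1 = - (f2 * Q1 a2 + f3 * Q1 a3).
  by apply/eqP; rewrite -addr_eq0 addrA e1.
have e2 : f2 * (a2 - f1 * Q1 a2) + f3 * (a3 - f1 * Q1 a3) = 0.
  by rewrite -e ea1; ring.
have := congr1 Q2 e2; rewrite Q2_0 Q2D Q2f2 Q2f3.
set w := Q2 _ => /eqP; rewrite addr_eq0 => /eqP ec2.
have e4 : f3 * (a3 - f1 * Q1 a3 - f2 * w) = 0 by rewrite -e2 ec2; ring.
have := congr1 Q3 e4; rewrite Q3_0 Q3f3 => /eqP; rewrite subr_eq0 => /eqP ec3.
exists w, (- Q1 a3), (Q1 a2); split.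
- by rewrite ea1; ring.
- by rewrite -[LHS](subrK (f1 * Q1 a2)) ec2; ring.
- by rewrite -[LHS](subrK (f1 * Q1 a3)) ec3; ring.
Qed.

(** The factor can only be the quotient [Q1 b1]. Applying [Q1] to the relations containing [f1]
    gives [b2] and [b3]; for [b1], the factor [f2] is cancelled by [Q2]. *)
Lemma koszul_exact2 b1 b2 b3 :
  b2 * f3 = b3 * f2 -> b3 * f1 = b1 * f3 -> b1 * f2 = b2 * f1 ->
  exists c, [/\ b1 = c * f1, b2 = c * f2 & b3 = c * f3].
Proof.
move=> e1 e2 e3.
have h2 : b2 = Q1 b1 * f2.
  by rewrite mulrC -Q1f2 mulrC e3 mulrC Q1f1.
have h3 : b3 = Q1 b1 * f3.
  by rewrite mulrC -Q1f3 mulrC -e2 mulrC Q1f1.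
exists (Q1 b1); split=> //.
rewrite -[LHS]Q2f2 mulrC e3 {1}h2 -[RHS]Q2f2; congr Q2; ring.
Qed.

Lemma koszul_exact3 c : c * f1 = 0 -> c = 0.
Proof. by rewrite mulrC => /(congr1 Q1); rewrite Q1_0 Q1f1. Qed.

End KoszulThree.

Section KoszulMatrices.
Variables (A : comNzRingType) (f : nat -> A).

Definition koszul_mx1 : 'M[A]_(3, 1) := \matrix_(i, j) f i.
(** On row vectors, the cross product with (f 0, f 1, f 2). *)
Definition koszul_mx2 : 'M[A]_3 := \matrix_(i, j)
  (nth [::] [:: [:: 0; - f 2; f 1]; [:: f 2; 0; - f 0]; [:: - f 1; f 0; 0]] i)`_j.
Definition koszul_mx3 : 'M[A]_(1, 3) := \matrix_(i, j) f j.

Lemma koszul_mx21 : koszul_mx2 *m koszul_mx1 = 0.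
Proof.
apply/matrixP => i j; rewrite !mxE !big_ord_recl big_ord0 !mxE.
by case: i => [[|[|[|]]]] //= _; rewrite /bump /=; ring.
Qed.

Lemma koszul_mx32 : koszul_mx3 *m koszul_mx2 = 0.
Proof.
apply/matrixP => i j; rewrite !mxE !big_ord_recl big_ord0 !mxE.
by case: j => [[|[|[|]]]] //= _; rewrite /bump /=; ring.
Qed.

Variable Q : nat -> A -> A.
Hypotheses (Q0 : forall i, Q i 0 = 0) (QD : forall i, {morph Q i : x y / x + y}).
Hypothesis Qf : forall i p, (i < 3)%N -> Q i (f i * p) = p.
Hypothesis QfC : forall i j p, (i < 3)%N -> (j < 3)%N -> i != j ->
  Q i (f j * p) = f j * Q i p.

Let row3 (q : 'rV[A]_3) (a b c : A) : q 0 ord0 = a -> q 0 (lift ord0 ord0) = b ->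
  q 0 (lift ord0 (lift ord0 ord0)) = c ->
  q = \row_j [:: a; b; c]`_j.
Proof.
move=> <- <- <-; apply/rowP => j; rewrite mxE.
by case: j => [[|[|[|]]]] //= h; congr (q 0 _); exact: val_inj.
Qed.

Lemma koszul_mx1_exact (q : 'rV_3) : q *m koszul_mx1 = 0 -> exists p, q = p *m koszul_mx2.
Proof.
move=> /matrixP/(_ 0 0); rewrite !mxE !big_ord_recl big_ord0 !mxE addr0 addrA.
rewrite ![q _ _ * _]mulrC /bump /= => e.
have C i k (hi : (i < 3)%N) (hk : (k < 3)%N) (ik : i != k) p := QfC p hi hk ik.
have D i (hi : (i < 3)%N) p := Qf p hi.
have [b1 [b2 [b3 [e1 e2 e3]]]] := koszul_exact1 (Q0 0%N) (Q0 1%N) (Q0 2%N) (QD 0%N) (QD 1%N)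
  (D 0%N isT) (C 0%N 1%N isT isT isT) (C 0%N 2%N isT isT isT)
  (D 1%N isT) (C 1%N 2%N isT isT isT) (D 2%N isT) e.
exists (\row_j [:: b1; b2; b3]`_j).
rewrite (row3 e1 e2 e3); apply/rowP => j; rewrite !mxE !big_ord_recl big_ord0 !mxE.
by case: j => [[|[|[|]]]] //= h; rewrite /bump /=; ring.
Qed.

Lemma koszul_mx2_exact (q : 'rV_3) : q *m koszul_mx2 = 0 -> exists p, q = p *m koszul_mx3.
Proof.
move=> /matrixP e; have e0 := e 0 ord0; have e1 := e 0 (lift ord0 ord0);
have e2 := e 0 (lift ord0 (lift ord0 ord0)).
move: e0 e1 e2; rewrite !mxE !big_ord_recl !big_ord0 !mxE /bump /=.
rewrite !(mulr0, addr0, add0r, mulrN) => /eqP; rewrite subr_eq0 => /eqP e0.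
rewrite addrC => /eqP; rewrite subr_eq0 => /eqP e1 /eqP; rewrite subr_eq0 => /eqP e2.
have C i k (hi : (i < 3)%N) (hk : (k < 3)%N) (ik : i != k) p := QfC p hi hk ik.
have D i (hi : (i < 3)%N) p := Qf p hi.
have [c [h0 h1 h2]] := koszul_exact2 (D 0%N isT) (C 0%N 1%N isT isT isT) (C 0%N 2%N isT isT isT)
  (D 1%N isT) e0 e1 e2.
exists c%:M; rewrite (row3 h0 h1 h2) mul_scalar_mx; apply/rowP => j; rewrite !mxE.
by case: j => [[|[|[|]]]].
Qed.

Lemma koszul_mx3_inj (q : 'rV_1) : q *m koszul_mx3 = 0 -> q = 0.
Proof.
move=> /matrixP/(_ 0 0); rewrite !mxE big_ord_recl big_ord0 !mxE addr0 => e.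
apply/rowP => j; rewrite ord1 [RHS]mxE.
by apply: (koszul_exact3 (Q1 := Q 0) _ _ e) => [|p]; rewrite ?Q0 ?Qf.
Qed.

End KoszulMatrices.

Section AdditiveExtension.
Variables (n : nat) (R : nzRingType) (V : zmodType) (h : 'X_{1..n} -> R -> V).
Hypotheses (h0 : forall m, h m 0 = 0) (hD : forall m, {morph h m : x y / x + y}).

(** Applied below both to polynomials in T and to their coefficients in x; maps such as division are
    additive on A but not S-linear. *)
Definition addext (p : {mpoly R[n]}) : V := \sum_(m <- msupp p) h m p@_m.

Lemma addextw k p : (msize p <= k)%N ->
  addext p = \sum_(m : 'X_{1..n < k}) h m p@_m.
Proof.
move=> hk; rewrite /addext (ssrcomplements.big_mksub 'X_{1..n < k}) //=; first last.
+ by move=> x /msize_mdeg_lt /leq_trans /(_ hk) ->.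
+ by rewrite msupp_uniq.
by rewrite big_rmcond //= => i /memN_msupp_eq0 ->.
Qed.

Lemma addext0 : addext 0 = 0.
Proof. by rewrite /addext msupp0 big_nil. Qed.

Lemma addextD : {morph addext : p q / p + q}.
Proof.
move=> p q; pose k := maxn (msize (p + q)) (maxn (msize p) (msize q)).
rewrite (addextw (k := k)) ?leq_maxl // (addextw (k := k) (p := p)) 1?(addextw (k := k) (p := q));
  try by rewrite /k !leq_max leqnn ?orbT.
by rewrite -big_split; apply: eq_bigr => m _; rewrite mcoeffD hD.
Qed.

Lemma addextZX c m : addext (c *: 'X_[m]) = h m c.
Proof.
have [->|nz] := eqVneq c 0; first by rewrite scale0r addext0 h0.
by rewrite /addext msuppMCX // big_seq1 mcoeffZ mcoeffX eqxx mulr1.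
Qed.

End AdditiveExtension.

(** * Division by x_i T_i - x_l T_l and the presentation of the Rees algebra *)

Section Rees.
Variables (K : fieldType) (n : nat) (l : 'I_n).
Local Notation S := {mpoly K[n]}.
Local Notation A := {mpoly S[n]}.

(* Locked, because unification otherwise compares exponents by computation. *)
Fact rmon_key : unit. Proof. by []. Qed.
Definition rmon : 'X_{1..n} -> 'X_{1..n} -> A :=
  locked_with rmon_key (fun m k => ('X_[m] : S) *: 'X_[k]).
Definition rz : 'I_n -> A := locked_with rmon_key (fun i => rmon U_(i)%MM U_(i)%MM).

Lemma rmonE m k : rmon m k = ('X_[m] : S) *: 'X_[k].
Proof. by rewrite /rmon unlock. Qed.

Lemma rzE i : rz i = rmon U_(i)%MM U_(i)%MM.
Proof. by rewrite /rz unlock. Qed.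

Lemma rmonM m k m' k' : rmon m k * rmon m' k' = rmon (m + m')%MM (k + k')%MM.
Proof. by rewrite !rmonE -scalerAl -scalerAr scalerA !mpolyXD. Qed.

Lemma rmon_prod (I : Type) (r : seq I) (P : pred I) (a b : I -> 'X_{1..n}) :
  \prod_(i <- r | P i) rmon (a i) (b i) =
  rmon (\sum_(i <- r | P i) a i)%MM (\sum_(i <- r | P i) b i)%MM.
Proof.
apply: (big_rec3 (fun x y z => z = rmon x y)) => [|i x y z _ ->].
  by rewrite rmonE !mpolyX0 scale1r.
by rewrite rmonM.
Qed.

Lemma rmonX m k e : rmon m k ^+ e = rmon (m *+ e)%MM (k *+ e)%MM.
Proof. by rewrite !rmonE exprZn !mpolyXn. Qed.

Lemma rees_ind (P : A -> Prop) : P 0 -> (forall p q, P p -> P q -> P (p + q)) ->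
  (forall (c : K) m k, P ((c%:MP : S) *: rmon m k)) -> forall p, P p.
Proof.
move=> P0 PD Pm p; rewrite [p]mpolyE; apply: big_ind => // k _.
rewrite [p@_k]mpolyE scaler_suml; apply: big_ind => // m _.
rewrite -[_ *: 'X_[m]]mul_mpolyC -scalerA -rmonE; exact: Pm.
Qed.

(** The K-linear extension of [g] from the monomials x^m T^k. *)
Definition rlin (g : 'X_{1..n} -> 'X_{1..n} -> A) : A -> A :=
  addext (fun k => addext (fun m (c : K) => (c%:MP : S) *: g m k)).

Lemma rlin0 g : rlin g 0 = 0. Proof. exact: addext0. Qed.

Lemma rlinD g : {morph rlin g : p q / p + q}.
Proof.
move=> p q; apply: addextD => k; first exact: addext0.
move=> x y; apply: addextD => m; first by rewrite mpolyC0 scale0r.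
by move=> c d; rewrite mpolyCD scalerDl.
Qed.

Lemma rlin_rmon g (c : K) m k : rlin g ((c%:MP : S) *: rmon m k) = (c%:MP : S) *: g m k.
Proof.
rewrite rmonE scalerA mul_mpolyC /rlin addextZX; last by move=> ?; exact: addext0.
by rewrite addextZX // => ?; rewrite mpolyC0 scale0r.
Qed.

(* Division of [x_i T_i - x_l T_l] by the leading term [x_i T_i]: the sum is the
   quotient of [u^e - v^e] by [u - v], where [u = x_i T_i], [v = x_l T_l] and
   [u^e] is the largest power of [u] dividing the monomial. *)
Definition rquo i : A -> A :=
  rlin (fun m k => \sum_(e < minn (m i) (k i))
    rz l ^+ e * rmon (m - U_(i) *+ e.+1)%MM (k - U_(i) *+ e.+1)%MM).

Lemma rquo0 i : rquo i 0 = 0. Proof. exact: rlin0. Qed.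
Lemma rquoD i : {morph rquo i : p q / p + q}. Proof. exact: rlinD. Qed.

(** Multiplying a monomial by x_i T_i adds one term to its quotient: the monomial itself. The other
    terms are the old ones times x_l T_l. *)
Lemma rquo_z i p : rquo i (rz i * p) = p + rz l * rquo i p.
Proof.
elim/rees_ind: p => [|p q hp hq|c m k].
- by rewrite !mulr0 rquo0 mulr0 addr0.
- by rewrite mulrDr !rquoD hp hq mulrDr addrACA.
rewrite -scalerAr rzE rmonM /rquo !rlin_rmon !mnmDE !mnm1E eqxx !add1n minnSS.
rewrite -[rz l * _]scalerAr -scalerDr big_ord_recl; congr (_ *: (_ + _)).
  by rewrite expr0 mul1r !mulm1n; congr rmon; rewrite addmC addmK.
rewrite mulr_sumr; apply: eq_bigr => e _.
rewrite lift0 exprS mulrA; congr (_ * rmon _ _);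
  by apply/mnmP => j; rewrite !(mnmBE, mnmDE, mulmnE, mnm1E); lia.
Qed.

(** x_j T_j does not change the exponents of x_i and T_i, hence not the number of terms. The case
    [j = l] together with [rquo_z] gives [rquo_f]. *)
Lemma rquo_zC i j p : j != i -> rquo i (rz j * p) = rz j * rquo i p.
Proof.
move=> ji; elim/rees_ind: p => [|p q hp hq|c m k].
- by rewrite mulr0 rquo0 mulr0.
- by rewrite mulrDr !rquoD hp hq mulrDr.
rewrite -scalerAr rzE rmonM /rquo !rlin_rmon -rzE !mnmDE !mnm1E (negPf ji) !add0n.
rewrite -scalerAr; congr (_ *: _); rewrite mulr_sumr; apply: eq_bigr => -[e he] _.
rewrite mulrCA (rzE j) rmonM /=; congr (_ * rmon _ _); apply/mnmP => t;
  rewrite !(mnmBE, mnmDE, mulmnE, mnm1E); case: (i =P t) => [<-|_];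
  rewrite ?(negPf ji); move: he; rewrite leq_min; lia.
Qed.

Definition rf i := rz i - rz l.

Lemma rquoN i p : rquo i (- p) = - rquo i p.
Proof. by apply/eqP; rewrite -addr_eq0 -rquoD addNr rquo0. Qed.

Lemma rquo_f i p : i != l -> rquo i (rf i * p) = p.
Proof.
move=> il; rewrite /rf mulrBl rquoD rquoN rquo_z rquo_zC 1?eq_sym //.
by rewrite addrK.
Qed.

Lemma rquo_fC i j p : i != l -> j != i -> rquo i (rf j * p) = rf j * rquo i p.
Proof.
move=> il ji; rewrite /rf !mulrBl rquoD rquoN !rquo_zC //.
by rewrite eq_sym.
Qed.

(** The cofactors are explicit because they later form the preimage in the first Koszul module. *)
Definition rees_ideal (p : A) := exists a, p = \sum_(i | i != l) rf i * a i.

Lemma rees_ideal0 : rees_ideal 0.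
Proof. by exists (fun=> 0); rewrite big1 // => i _; rewrite mulr0. Qed.

Lemma rees_idealD p q : rees_ideal p -> rees_ideal q -> rees_ideal (p + q).
Proof.
move=> [a ->] [b ->]; exists (fun i => a i + b i).
by rewrite -big_split; apply: eq_bigr => i _; rewrite mulrDr.
Qed.

Lemma rees_idealM r p : rees_ideal p -> rees_ideal (p * r).
Proof.
move=> [a ->]; exists (fun i => a i * r).
by rewrite mulr_suml; apply: eq_bigr => i _; rewrite mulrA.
Qed.

(** Modulo the ideal each x_j T_j becomes x_l T_l: a difference of powers is a multiple of [rf j],
    and a difference of products telescopes. *)
Lemma rees_ideal_prod (e : 'I_n -> nat) :
  rees_ideal (\prod_(j | j != l) rz j ^+ e j - \prod_(j | j != l) rz l ^+ e j).
Proof.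
elim/big_ind2: _ => [|p' p q' q hp hq|i il].
- by rewrite subrr; exact: rees_ideal0.
- have -> : p * q - p' * q' = (p - p') * q + (q - q') * p' by ring.
  by apply: rees_idealD; apply: rees_idealM.
rewrite subrXX; apply: rees_idealM; exists (fun j => (j == i)%:R).
rewrite (bigD1 i) //= eqxx mulr1 big1 ?addr0 // => j /andP[_ /negPf->].
by rewrite mulr0.
Qed.

Definition yvar i : S := 'X_[[multinom (i != j : nat) | j < n]].

Lemma yvar_monomial k : ('X_[k] : A).@[yvar] = 'X_[[multinom mdeg k - k j | j < n]].
Proof.
rewrite mevalX; under eq_bigr do rewrite /yvar mpolyXn.
rewrite -(big_morph _ (@mpolyXD _ _) (@mpolyX0 _ _)); congr 'X_[_].
apply/mnmP => j; rewrite mnm_sumE mnmE mdegE [in RHS](bigD1 j) //= addKn.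
rewrite (bigD1 j) //= !(mulmnE, mnmE) eqxx mul0n add0n.
by apply: eq_bigr => i ij; rewrite mulmnE mnmE ij mul1n.
Qed.

(* The normal form, modulo the [x_i T_i - x_l T_l], of the monomials of T-degree
   [s] that are mapped to [x^g]. *)
Definition rsection (s : nat) (g : 'X_{1..n}) : A :=
  let b := (s - \sum_(j | j != l) (s - g j))%N in
  rmon [multinom if j == l then g l + b - s else g j - s | j < n]%N
       [multinom if j == l then b else s - g j | j < n]%N.

(** The largest product of powers of the x_j T_j with j other than l is split off and turned into a
    power of x_l T_l. What remains contains at most one of x_j and T_j, with an exponent read off
    from the difference of [m j] and [k j], which the image and the T-degree determine. *)
Lemma rmon_section m k :
  rees_ideal (rmon m k - rsection (mdeg k) (m + [multinom mdeg k - k j | j < n])%MM).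
Proof.
pose e j := minn (m j) (k j).
pose E : 'X_{1..n} := [multinom if j == l then 0%N else e j | j < n].
have eE : \prod_(j | j != l) rz j ^+ e j = rmon E E.
  under eq_bigr do rewrite rzE rmonX.
  rewrite rmon_prod; suff -> : (\sum_(i | i != l) U_(i) *+ e i)%MM = E by [].
  apply/mnmP => j; rewrite mnm_sumE mnmE; have [->|jl] := eqVneq j l.
    by rewrite big1 // => i /negPf il; rewrite mulmnE mnm1E il.
  rewrite (bigD1 j) //= mulmnE mnm1E eqxx mul1n big1 ?addn0 // => i /andP[_ /negPf ij].
  by rewrite mulmnE mnm1E ij.
have kle j : (k j <= mdeg k)%N by rewrite mdegE (bigD1 j) //= leq_addr.
have := rees_idealM (rmon (m - E)%MM (k - E)%MM) (rees_ideal_prod e).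
rewrite [X in X - _]eE [X in _ - X]prodrXr mulrBl rmonM rzE rmonX rmonM.
suff [<- <-] : m = (E + (m - E))%MM /\ k = (E + (k - E))%MM.
  congr (rees_ideal (_ - _)); rewrite /rsection.
  set c := (\sum_(j | j != l) e j)%N.
  set b := (mdeg k - \sum_(j | j != l) _)%N.
  have eb : b = (k l + c)%N.
    have -> : b = (mdeg k - \sum_(j | j != l) (k j - m j))%N.
      congr (_ - _)%N; apply: eq_bigr => j _; rewrite mnmDE mnmE.
      by have := kle j; lia.
    rewrite mdegE (bigD1 l) //=.
    have -> : (\sum_(j | j != l) k j = c + \sum_(j | j != l) (k j - m j))%N.
      by rewrite -big_split; apply: eq_bigr => j _ /=; rewrite /e; lia.
    by rewrite addnA addnK.
  congr rmon; apply/mnmP => j; rewrite !(mnmBE, mnmDE, mulmnE, mnm1E, mnmE);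
    have := kle j; have := kle l; rewrite [l == j]eq_sym;
    case: (j =P l) => [->|_]; rewrite ?eb /e; lia.
by split; apply/mnmP => j; rewrite !(mnmDE, mnmBE, mnmE) /e; case: eqP => _; lia.
Qed.

(** [L] sends x^g to the normal form of T-degree [s] lying over it, so by [rmon_section] every form
    [q] is congruent to [L] of its image, here 0. *)
Lemma rees_kernel s (q : A) : q \is s.-homog -> q.@[yvar] = 0 -> rees_ideal q.
Proof.
move=> hq q0.
pose L := addext (fun g (c : K) => (c%:MP : S) *: rsection s g).
have L0 : L 0 = 0 by exact: addext0.
have LD : {morph L : x y / x + y}.
  apply: addextD => m; first by rewrite mpolyC0 scale0r.
  by move=> c d; rewrite mpolyCD scalerDl.
suff : rees_ideal (q - L q.@[yvar]) by rewrite q0 L0 subr0.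
(* Only the equation for [P] is kept, so that unification cannot look into its body. *)
have [P hP] : exists P, forall p, P p = rees_ideal (p - L p.@[yvar]).
  by exists (fun p => rees_ideal (p - L p.@[yvar])).
have P0 : P 0 by rewrite hP meval0 L0 subr0; exact: rees_ideal0.
have PD p r : P p -> P r -> P (p + r).
  rewrite !hP mevalD LD opprD addrACA; exact: rees_idealD.
rewrite -hP [q]mpolyE big_seq; apply: big_ind => // k kq.
rewrite [q@_k]mpolyE scaler_suml; apply: big_ind => // m _; rewrite hP.
rewrite mevalZ yvar_monomial -scalerAl -mpolyXD.
rewrite /L addextZX; last by move=> ?; rewrite mpolyC0 scale0r.
rewrite -[_ *: 'X_[m]]mul_mpolyC -scalerA -rmonE.
rewrite -scalerBr -(dhomog_mf hq kq) -[_ *: (_ - _)]mul_mpolyC mulrC.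
by apply: rees_idealM; exact: rmon_section.
Qed.

End Rees.

(** * Strands of fixed T-degree *)

Lemma pihomogM (R : nzRingType) n d e (p q : {mpoly R[n]}) : q \is e.-homog ->
  pihomog mdeg (d + e) (p * q) = pihomog mdeg d p * q.
Proof.
move=> hq; have hk := leqnn (mmeasure mdeg p).
rewrite [in LHS](pihomog_partitionE hk) mulr_suml raddf_sum.
rewrite [in RHS](pihomog_partitionE hk) raddf_sum mulr_suml.
apply: eq_bigr => i _ /=; have hi := pihomogP mdeg i p.
have [<-|ne] := eqVneq (i : nat) d; first by rewrite (pihomog_dE (dhomogM hi hq)) (pihomog_dE hi).
rewrite (pihomog_ne0 ne hi) mul0r (pihomog_ne0 _ (dhomogM hi hq)) //.
by rewrite eqn_add2r.
Qed.

Lemma mcoeff_pihomog (R : nzRingType) n d (p : {mpoly R[n]}) m :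
  (pihomog mdeg d p)@_m = if mdeg m == d then p@_m else 0.
Proof.
rewrite pihomogE raddf_sum big_mkcond /= [in RHS](mpolyE p) raddf_sum /=.
have -> : (if mdeg m == d then \sum_(k <- msupp p) (p@_k *: 'X_[k])@_m else 0) =
    \sum_(k <- msupp p) if mdeg m == d then (p@_k *: 'X_[k])@_m else 0.
  by case: ifP => // _; rewrite big1.
apply: eq_bigr => k _; rewrite mcoeffZ mcoeffX.
by case: (k =P m) => [->|_] //; rewrite mulr0 !if_same.
Qed.

Section Strands.
Variables (K : fieldType) (n : nat).
Local Notation S := {mpoly K[n]}.
Local Notation A := {mpoly S[n]}.

Definition dmonos d : seq 'X_{1..n} :=
  [seq s2m (t : seq 'I_n) | t : d.-tuple 'I_n <- enum (basis n d)].

Lemma mem_dmonos d m : (m \in dmonos d) = (mdeg m == d).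
Proof. by rewrite -basis_cover. Qed.

Lemma dmonos_uniq d : uniq (dmonos d).
Proof. exact: uniq_basis. Qed.

Local Notation N d := (size (dmonos d)).

Definition dmono d (i : 'I_(N d)) : 'X_{1..n} := nth 0%MM (dmonos d) i.

Lemma mdeg_dmono d (i : 'I_(N d)) : mdeg (dmono i) = d.
Proof. by apply/eqP; rewrite -mem_dmonos mem_nth. Qed.

Lemma eq_dmono d (i j : 'I_(N d)) : (dmono i == dmono j) = (i == j).
Proof. by rewrite nth_uniq ?dmonos_uniq. Qed.

Lemma dmono_surj d m : mdeg m = d -> exists i : 'I_(N d), m = dmono i.
Proof.
move=> hm; have mi : m \in dmonos d by rewrite mem_dmonos hm.
by exists (Ordinal (n := N d) (m := index m (dmonos d)) ltac:(by rewrite index_mem));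
  rewrite /dmono nth_index.
Qed.

(** Coordinates of the part of T-degree [d] of A^r, a free S-module with a basis indexed by
    positions and monomials; other T-degrees are dropped. [spoly] is the embedding back. *)
Definition scoef d r (q : 'rV[A]_r) : 'rV[S]_(r * N d) :=
  mxvec (\matrix_(j, i) (q 0 j)@_(dmono i)).

Definition spoly d r (v : 'rV[S]_(r * N d)) : 'rV[A]_r :=
  \row_j \sum_i vec_mx v j i *: 'X_[dmono i].

Lemma spolyK d r : cancel (@spoly d r) (@scoef d r).
Proof.
move=> v; rewrite /scoef -[RHS]vec_mxK; congr mxvec; apply/matrixP => j i.
rewrite mxE [spoly v 0 j]mxE raddf_sum (bigD1 i) //= mcoeffZ mcoeffX eqxx mulr1.
rewrite big1 ?addr0 // => i' ne.
by rewrite mcoeffZ mcoeffX eq_dmono (negPf ne) mulr0.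
Qed.

Lemma scoefK d r (q : 'rV[A]_r) :
  spoly (scoef d q) = map_mx (pihomog mdeg d) q.
Proof.
apply/rowP => j; rewrite !mxE /scoef mxvecK; apply/mpolyP => m.
transitivity (if mdeg m == d then (q 0 j)@_m else 0); last first.
  by rewrite mcoeff_pihomog.
rewrite raddf_sum /=; have [md|md] := eqVneq (mdeg m) d.
  have [i ->] := dmono_surj md.
  rewrite (bigD1 i) //= mxE mcoeffZ mcoeffX eqxx mulr1 big1 ?addr0 // => i' ne.
  by rewrite mcoeffZ mcoeffX eq_dmono (negPf ne) mulr0.
rewrite big1 // => i _; rewrite mcoeffZ mcoeffX.
by case: eqP => [e|_]; [rewrite -e mdeg_dmono eqxx in md | rewrite mulr0].
Qed.

Lemma spoly_homog d r (v : 'rV[S]_(r * N d)) j : spoly v 0 j \is d.-homog.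
Proof.
by rewrite mxE rpred_sum // => i _; rewrite rpredZ // dhomogX; apply/eqP/mdeg_dmono.
Qed.

Lemma spolyP d r c (u v : 'rV[S]_(r * N d)) :
  spoly (c *: u + v) = c%:MP *: spoly u + spoly v.
Proof.
apply/rowP => j; rewrite !mxE mulr_sumr -big_split; apply: eq_bigr => i _ /=.
by rewrite linearP !mxE scalerDl mul_mpolyC scalerA.
Qed.

Lemma scoefP d r c (p q : 'rV[A]_r) :
  scoef d (c%:MP *: p + q) = c *: scoef d p + scoef d q.
Proof.
rewrite /scoef -linearP; congr mxvec; apply/matrixP => j i; rewrite !mxE.
by rewrite mcoeffD mcoeffCM.
Qed.

(** With [e] a free parameter, no equation between degrees enters the types. For entries of T-degree
    1 and [e = d.+1], the truncation in [scoef] loses nothing, by [spoly_strand]. *)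
Definition strand_map d e r r' (D : 'M[A]_(r, r')) (v : 'rV[S]_(r * N d)) :=
  scoef e (spoly v *m D).

Fact strand_map_linear d e r r' (D : 'M[A]_(r, r')) : linear (@strand_map d e r r' D).
Proof.
by move=> c u v; rewrite /strand_map spolyP mulmxDl -scalemxAl scoefP.
Qed.

HB.instance Definition _ d e r r' (D : 'M[A]_(r, r')) :=
  GRing.isLinear.Build S _ _ _ (@strand_map d e r r' D) (@strand_map_linear d e r r' D).

Definition strand_mx d e r r' (D : 'M[A]_(r, r')) := lin1_mx (@strand_map d e r r' D).

Definition linear_entries r r' (D : 'M[A]_(r, r')) := forall i j, D i j \is 1.-homog.

Lemma spoly_strand d r r' (D : 'M[A]_(r, r')) v : linear_entries D ->
  spoly (v *m strand_mx d d.+1 D) = spoly v *m D.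
Proof.
move=> hD; rewrite mul_rV_lin1 scoefK; apply/rowP => j; rewrite mxE pihomog_dE //.
rewrite mxE rpred_sum // => i _; rewrite -(addn1 d); apply: dhomogM; last exact: hD.
exact: spoly_homog.
Qed.

Lemma spoly0 d r : spoly (0 : 'rV[S]_(r * N d)) = 0.
Proof.
by apply/rowP => j; rewrite !mxE big1 // => i _; rewrite linear0 mxE scale0r.
Qed.

(** The preimage [p] may have components in all T-degrees; as [D] raises the T-degree by exactly 1,
    its component of degree [d] already maps to [spoly v]. *)
Lemma strand_image d r r' (D : 'M[A]_(r, r')) (v : 'rV_(r' * N d.+1)) p :
  linear_entries D -> spoly v = p *m D -> v = scoef d p *m strand_mx d d.+1 D.
Proof.
move=> hD ep; apply: (can_inj (@spolyK d.+1 r')).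
rewrite (spoly_strand _ hD) (scoefK d p).
have -> : spoly v = map_mx (pihomog mdeg d.+1) (spoly v).
  by apply/rowP => j; rewrite [RHS]mxE pihomog_dE // spoly_homog.
rewrite ep; apply/rowP => j.
rewrite [RHS]mxE [LHS]mxE [X in pihomog _ _ X]mxE raddf_sum; apply: eq_bigr => i _.
by rewrite [X in _ = X * _]mxE /= -(pihomogM d _ (hD i j)) addn1.
Qed.

Lemma strand_exact d r1 r2 r3 (D : 'M[A]_(r1, r2)) (D' : 'M[A]_(r2, r3)) :
  linear_entries D -> linear_entries D' -> D *m D' = 0 ->
  (forall q : 'rV_r2, q *m D' = 0 -> exists p, q = p *m D) ->
  forall v : 'rV_(r2 * N d.+1),
  v *m strand_mx d.+1 d.+2 D' = 0 <-> exists w, v = w *m strand_mx d d.+1 D.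
Proof.
move=> hD hD' DD' ex v; split.
  move=> /(congr1 (@spoly _ _)); rewrite spoly_strand // spoly0 => /ex[p ep].
  by exists (scoef d p); exact: strand_image.
move=> [w ->]; apply: (can_inj (@spolyK d.+2 r3)).
by rewrite !spoly_strand // -mulmxA DD' mulmx0 spoly0.
Qed.

Definition augment_map (y : 'I_n -> S) d (v : 'rV[S]_(1 * N d)) : 'rV[S]_1 :=
  \row_j (spoly v 0 j).@[y].

Fact augment_map_linear y d : linear (@augment_map y d).
Proof.
move=> c u v; apply/rowP => j; rewrite /augment_map spolyP !mxE.
by rewrite mevalD mevalM mevalC.
Qed.

HB.instance Definition _ y d :=
  GRing.isLinear.Build S _ _ _ (@augment_map y d) (@augment_map_linear y d).

Definition augment_mx y d := lin1_mx (@augment_map y d).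

Lemma mul_augment_mx y d (v : 'rV_(1 * N d)) : v *m augment_mx y d = (spoly v 0 0).@[y]%:M.
Proof.
by rewrite mul_rV_lin1; apply/rowP => j; rewrite !mxE ord1 mulr1n.
Qed.

Lemma spoly_delta d r j i :
  spoly (delta_mx 0 (mxvec_index j i) : 'rV_(r * N d)) = 'X_[dmono i] *: delta_mx 0 j.
Proof.
apply/rowP => k; rewrite !mxE (bigD1 i) //= big1 => [|i' ne].
  rewrite vec_mx_delta !mxE eqxx andbT addr0.
  by case: (k == j); rewrite ?scale1r ?scale0r ?mulr1 ?mulr0.
by rewrite vec_mx_delta mxE (negPf ne) andbF scale0r.
Qed.

(** The degree here is that in x, not in T: every entry of the strand matrix is 0 or a coefficient
    of an entry of [D]. *)
Lemma strand_mx_homog d e r r' (D : 'M[A]_(r, r')) :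
  (forall i j k, (D i j)@_k \is 1.-homog) ->
  forall a b, strand_mx d e D a b \is 1.-homog.
Proof.
move=> hD a b; case/mxvec_indexP: a => j i; case/mxvec_indexP: b => j' i'.
rewrite mxE /= /strand_map spoly_delta -scalemxAl /scoef mxvecE mxE -rowE !mxE.
set p := D j j'; have hp k : p@_k \is 1.-homog by exact: hD.
rewrite [p]mpolyE mulr_sumr raddf_sum rpred_sum // => k _ /=.
rewrite -scalerAr -mpolyXD mcoeffZ mcoeffX.
by case: eqP; rewrite ?mulr1 ?mulr0 ?rpred0.
Qed.

Lemma augment_mx_delta y d i k :
  augment_mx y d (mxvec_index 0 i) k = ('X_[dmono i] : A).@[y].
Proof.
rewrite mxE /= /augment_map spoly_delta !mxE ord1.
by rewrite eqxx mulr1.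
Qed.

Lemma augment_mx_image y d (p : S) :
  (exists w, p%:M = w *m augment_mx y d) <->
  (exists2 q : A, q \is d.-homog & p = q.@[y]).
Proof.
split=> [[w /matrixP /(_ 0 0)]|[q hq ->]].
  rewrite mul_augment_mx mxE [RHS]mxE !mulr1n => ->.
  by exists (spoly w 0 0) => //; exact: spoly_homog.
exists (scoef d (q%:M : 'rV_1)); rewrite mul_augment_mx scoefK mxE.
by rewrite mxE mulr1n pihomog_dE.
Qed.

End Strands.

(** * Powers of the ideal and their resolutions *)

Section IdealPowers.
Variable K : fieldType.
Local Notation S := {mpoly K[4]}.
Local Notation A := {mpoly S[4]}.

Lemma ideal_gen_incl (R : comNzRingType) (T : R -> Prop) g : T g -> g \in ideal_gen T.
Proof.
move=> Tg; apply/ideal_genP; exists [:: (1, g)]; rewrite big_seq1 mul1r.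
by split=> // cg; rewrite inE => /eqP->.
Qed.

Lemma ideal_gen_ind (R : comNzRingType) (T P : R -> Prop) :
  P 0 -> (forall p q, P p -> P q -> P (p + q)) ->
  (forall c g, T g -> P (c * g)) -> forall p, p \in ideal_gen T -> P p.
Proof.
move=> P0 PD PM p /ideal_genP[r [Tr ->]]; rewrite big_seq.
by apply: big_ind => // cg /Tr; exact: PM.
Qed.

Lemma ord4P (P : 'I_4 -> Prop) :
  P (inord 0) -> P (inord 1) -> P (inord 2) -> P (inord 3) -> forall i, P i.
Proof.
move=> p0 p1 p2 p3 i; rewrite -[i]inord_val.
by case: i => [[|[|[|[|]]]]].
Qed.

Lemma gensP g : g \in gens K <-> exists i, g = yvar K i.
Proof.
have e : gens K = [:: yvar K (inord 3); yvar K (inord 2); yvar K (inord 1); yvar K (inord 0)].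
  rewrite /gens /x1 /x2 /x3 /x4 -!mpolyXD /yvar.
  by congr [:: 'X_[_]; 'X_[_]; 'X_[_]; 'X_[_]]; apply/mnmP; elim/ord4P;
    rewrite !(mnmDE, mnm1E, mnmE) -!val_eqE /= !inordK.
rewrite e !inE; split=> [/or4P[]/eqP->|[]]; try by eexists.
by elim/ord4P => ->; rewrite eqxx ?orbT.
Qed.

(** A product of elements of I and I^s is the value of a product of forms in T. Conversely, a
    monomial of T-degree [s.+1] contains some T_i, which splits off as a generator of I. *)
Lemma hideal_expP s (p : S) :
  p \in hideal_exp (squarefree3_ideal K) s <->
  exists2 q : A, q \is s.-homog & p = q.@[@yvar K 4].
Proof.
elim: s p => [|s ih] p.
  split=> _; first by exists p%:MP; rewrite ?mevalC // dhomogE msuppC; case: eqP; rewrite //= mdeg0.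
  rewrite -[p]mulr1; apply: (@rpredZ _ _ (ideal_gen (fun g : S => g = 1)) p 1).
  exact: ideal_gen_incl.
split.
  apply: (@ideal_gen_ind _ _ (fun p => exists2 q : A, q \is s.+1.-homog & p = q.@[@yvar K 4])).
  - by exists 0; rewrite ?rpred0 // meval0.
  - by move=> a b [q hq ->] [r hr ->]; exists (q + r); rewrite ?rpredD // mevalD.
  move=> c _ [a [b [ha /ih[q hq ->] ->]]].
  have [r hr ->] : exists2 r : A, r \is 1.-homog & a = r.@[@yvar K 4].
    move: a ha; apply: ideal_gen_ind.
    - by exists 0; rewrite ?rpred0 // meval0.
    - by move=> a b' [r hr ->] [r' hr' ->]; exists (r + r'); rewrite ?rpredD // mevalD.
    move=> c' g /gensP[i ->]; exists (c' *: 'X_i); last by rewrite mevalZ mevalXU.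
    by rewrite rpredZ // dhomogX; apply/eqP/mdeg1.
  exists (c *: (r * q)); last by rewrite mevalZ mevalM.
  by rewrite rpredZ //; exact: (dhomogM hr hq).
move=> [q hq ->]; rewrite [q]mpolyE big_seq raddf_sum.
apply: (rpred_sum (S := hideal_exp (squarefree3_ideal K) s.+1)) => k kq /=.
rewrite mevalZ; apply: (@rpredZ _ _ (hideal_exp (squarefree3_ideal K) s.+1)).
have mk := dhomog_mf hq kq.
have [i ki] : exists i, k i != 0%N.
  apply/existsP; rewrite -negb_forall; apply/negP => /forallP hz.
  by move: mk; rewrite /= mdegE big1 // => i _; apply/eqP.
have -> : k = (U_(i) + (k - U_(i)))%MM by rewrite addmC submK // lep1mP.
rewrite mpolyXD mevalM; apply: ideal_gen_incl.
exists ('X_i : A).@[@yvar K 4], ('X_[k - U_(i)] : A).@[@yvar K 4]; split=> //.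
  by apply: ideal_gen_incl; apply/gensP; exists i; rewrite mevalXU.
apply/ih; exists 'X_[k - U_(i)] => //; rewrite dhomogX.
by rewrite -(eqn_add2r (mdeg U_(i)%MM)) -mdegD submK ?lep1mP // mdeg1 addn1; apply/eqP.
Qed.

End IdealPowers.

(** * The linear strands of the Koszul complex *)

Section Resolution.
Variable K : fieldType.
Local Notation S := {mpoly K[4]}.
Local Notation A := {mpoly S[4]}.
Local Notation N d := (size (dmonos 4 d)).

Definition kf (i : nat) : A := rf K (inord 3) (inord i).

Lemma inord4_neq i j : (i < 4)%N -> (j < 4)%N -> i != j -> (inord i : 'I_4) != inord j.
Proof. by move=> hi hj ij; rewrite -val_eqE /= !inordK. Qed.

Lemma kf_linear i : kf i \is 1.-homog.
Proof. have h j : rz K j \is 1.-homog by rewrite rzE rmonE rpredZ // dhomogX; apply/eqP/mdeg1.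
by apply: rpredB; exact: h. Qed.

Lemma kf_coef_linear i k : (kf i)@_k \is 1.-homog.
Proof.
have h j : (rz K j)@_k \is 1.-homog.
  rewrite rzE rmonE mcoeffZ mcoeffX; case: eqP => _; rewrite ?mulr0 ?rpred0 // mulr1.
  by rewrite dhomogX; apply/eqP/mdeg1.
by rewrite mcoeffB; apply: rpredB; exact: h.
Qed.

Lemma kf_eval i : (kf i).@[@yvar K 4] = 0.
Proof.
have h j : (rz K j).@[@yvar K 4] = 'X_[[multinom 1%N | _ < 4]].
  rewrite rzE rmonE mevalZ mevalXU -mpolyXD; congr 'X_[_]; apply/mnmP => t.
  by rewrite mnmDE mnm1E !mnmE; case: eqP.
by rewrite mevalB !h subrr.
Qed.

Lemma sum_neq_last (V : nmodType) (F : 'I_4 -> V) :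
  \sum_(i | i != inord 3) F i = \sum_(j < 3) F (inord j).
Proof.
have e3 : ord_max = inord 3 :> 'I_4 by apply: val_inj; rewrite /= inordK.
rewrite big_mkcond big_ord_recr /= e3 eqxx addr0; apply: eq_bigr => j _.
have -> : widen_ord (leqnSn 3) j = inord j.
  by apply: val_inj; rewrite /= inordK // ltnS ltnW.
by rewrite inord4_neq // ?ltn_eqF // ltnS ltnW.
Qed.

Local Notation kd1 := (koszul_mx1 kf).
Local Notation kd2 := (koszul_mx2 kf).
Local Notation kd3 := (koszul_mx3 kf).

Lemma koszul_mx2_ind (P : A -> Prop) : P 0 -> (forall i, P (kf i)) ->
  (forall i, P (- kf i)) -> forall i j, P (kd2 i j).
Proof.
move=> P0 Pf PN i j; rewrite mxE.
case: i => -[|[|[|//]]] hi; case: j => -[|[|[|//]]] hj;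
  [exact: P0 | exact: PN | exact: Pf | exact: Pf | exact: P0 | exact: PN
  | exact: PN | exact: Pf | exact: P0].
Qed.

Lemma kd1_linear : linear_entries kd1.
Proof. by move=> i j; rewrite mxE; exact: kf_linear. Qed.

Lemma kd3_linear : linear_entries kd3.
Proof. by move=> i j; rewrite mxE; exact: kf_linear. Qed.

Lemma kd2_linear : linear_entries kd2.
Proof.
by apply: (koszul_mx2_ind (P := fun p => p \is 1.-homog)) => [|i|i];
  rewrite ?rpredN ?rpred0 //; exact: kf_linear.
Qed.

Let Q (i : nat) := rquo (K := K) (inord 3 : 'I_4) (inord i).

Let Q0 i : Q i 0 = 0. Proof. exact: rquo0. Qed.
Let QD i : {morph Q i : x y / x + y}. Proof. exact: rquoD. Qed.
Let Qf i p : (i < 3)%N -> Q i (kf i * p) = p.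
Proof. by move=> hi; apply: rquo_f; apply: inord4_neq; rewrite ?ltn_eqF // leqW. Qed.
Let QfC i j p : (i < 3)%N -> (j < 3)%N -> i != j -> Q i (kf j * p) = kf j * Q i p.
Proof.
move=> hi hj ij; apply: rquo_fC.
  by apply: inord4_neq; rewrite ?ltn_eqF // leqW.
by apply: inord4_neq; [exact: leqW | exact: leqW | rewrite eq_sym].
Qed.

(** The cofactors provided by [rees_kernel], cut down to T-degree [d], form the preimage. *)
Lemma augment_exact d (v : 'rV_(1 * N d.+1)) :
  v *m augment_mx (@yvar K 4) d.+1 = 0 <-> exists w, v = w *m strand_mx d d.+1 kd1.
Proof.
rewrite mul_augment_mx; split=> [/matrixP/(_ 0 0)|[w ->]]; last first.
  rewrite spoly_strand; last exact: kd1_linear.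
  rewrite mxE (raddf_sum (meval (@yvar K 4))) big1 ?raddf0 // => i _.
  by rewrite [kd1 _ _]mxE [LHS]mevalM kf_eval mulr0.
rewrite mxE [RHS]mxE mulr1n => hv.
have [a ea] := rees_kernel (inord 3) (spoly_homog v 0) hv.
exists (scoef d (\row_j a (inord j))); apply: strand_image; first exact: kd1_linear.
apply/rowP => j; rewrite ord1 ea sum_neq_last mxE; apply: eq_bigr => i _.
by rewrite !mxE mulrC.
Qed.

(** Here [k] is s - 3, which 3 <= s permits, so the T-degrees s, ..., s - 3 involve no truncated
    subtraction. The factor 1 keeps the shape required by [strand_mx]. *)
Definition linear_rank k i : nat :=
  match i with
  | 0 => 1 * N k.+3 | 1 => 3 * N k.+2 | 2 => 3 * N k.+1 | 3 => 1 * N k | _ => 0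
  end.

Definition linear_diff k i : 'M[S]_(linear_rank k i.+1, linear_rank k i) :=
  match i with
  | 0 => strand_mx k.+2 k.+3 kd1
  | 1 => strand_mx k.+1 k.+2 kd2
  | 2 => strand_mx k k.+1 kd3
  | _ => 0
  end.

Definition linear_seq k : freeSeq K 4 :=
  FreeSeq (fun i (_ : 'I_(linear_rank k i)) => (3 * k.+3 + i)%:Z) (linear_diff k).

Lemma linear_diff_homog k i a b : linear_diff k i a b \is 1.-homog.
Proof.
case: i a b => [|[|[|i]]] a b /=; last by rewrite mxE rpred0.
- by apply: strand_mx_homog => *; rewrite mxE; exact: kf_coef_linear.
- apply: strand_mx_homog => j j' t; move: j j'.
  by apply: (koszul_mx2_ind (P := fun p => p@_t \is 1.-homog)) => [|i'|i'];
  rewrite ?mcoeffN ?rpredN ?mcoeff0 ?rpred0 //; exact: kf_coef_linear.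
- by apply: strand_mx_homog => *; rewrite mxE; exact: kf_coef_linear.
Qed.

Lemma linear_diff_exact k i (v : 'rV_(linear_rank k i.+1)) :
  v *m linear_diff k i = 0 <-> exists w, v = w *m linear_diff k i.+1.
Proof.
case: i v => [|[|[|i]]] v /=.
- apply: strand_exact; [exact: kd2_linear|exact: kd1_linear|exact: koszul_mx21|].
  exact: (koszul_mx1_exact Q0 QD Qf QfC).
- apply: strand_exact; [exact: kd3_linear|exact: kd2_linear|exact: koszul_mx32|].
  exact: (koszul_mx2_exact Qf QfC).
(* The last Koszul map is injective, and the module after it is 0. *)
- split=> [/(congr1 (@spoly _ _ _ _))|[w ->]]; last by rewrite mulmx0 mul0mx.
  rewrite spoly_strand; last exact: kd3_linear.
  rewrite spoly0 => /(koszul_mx3_inj Q0 Qf) h.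
  exists 0; rewrite mul0mx; apply: (can_inj (@spolyK _ _ k 1)).
  by rewrite h spoly0.
- by rewrite mulmx0; split=> // _; exists 0; rewrite mul0mx; apply/rowP => -[].
Qed.

Lemma linear_seq_minimal k : minimal (linear_seq k).
Proof.
move=> i a b; apply: (dhomog_nemf_coeff (linear_diff_homog a b)).
by rewrite /= mdeg0.
Qed.

End Resolution.

(** * Resolutions of I^s and R/I^s, Betti numbers and regularity *)

Section MinimalResolutions.
Variable K : fieldType.
Local Notation S := {mpoly K[4]}.
Local Notation A := {mpoly S[4]}.
Local Notation N d := (size (dmonos 4 d)).
Local Notation I := (squarefree3_ideal K).

Lemma size_dmonos d : N d = 'C(d + 3, 3).
Proof. by rewrite size_basis -bin_sub ?leq_addr // addKn. Qed.

Lemma augment_mx_homog d a b : augment_mx (@yvar K 4) d a b \is (3 * d).-homog.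
Proof.
case/mxvec_indexP: a => j i; rewrite (ord1 j) augment_mx_delta yvar_monomial dhomogX.
apply/eqP; have hd := mdeg_dmono i; set m := dmono i in hd *.
have hm t : (m t <= mdeg m)%N by rewrite mdegE (bigD1 t) //= leq_addr.
rewrite /= mdegE -[in RHS]hd; under eq_bigr do rewrite mnmE.
have e : (\sum_t (mdeg m - m t) + mdeg m = 4 * mdeg m)%N.
  rewrite [X in (_ + X)%N]mdegE -big_split /=.
  rewrite (eq_bigr (fun=> mdeg m)) ?sum_nat_const ?card_ord // => t _.
  by rewrite subnK.
lia.
Qed.

Lemma augment_mx_ideal s (v : 'rV_(1 * N s)) :
  (v *m augment_mx (@yvar K 4) s) 0 0 \in hideal_exp I s.
Proof.
apply/hideal_expP/augment_mx_image; exists v; apply/rowP => j.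
by rewrite mxE ord1 mulr1n.
Qed.

Definition ideal_augment s (v : 'rV_(1 * N s)) : ideal_module (hideal_exp I s) :=
  Submodule (augment_mx_ideal v).

Fact ideal_augment_linear s : linear (@ideal_augment s).
Proof. by move=> c u v; apply: val_inj; rewrite /= mulmxDl -scalemxAl !mxE. Qed.

HB.instance Definition _ s := GRing.isLinear.Build S _ _ _ (@ideal_augment s)
  (@ideal_augment_linear s).

Lemma augment_mx_eq0 s (v : 'rV_(1 * N s)) :
  (v *m augment_mx (@yvar K 4) s) 0 0 = 0 <-> v *m augment_mx (@yvar K 4) s = 0.
Proof.
split=> [h|->]; last by rewrite mxE.
by apply/rowP => j; rewrite ord1 h mxE.
Qed.

Lemma linear_seq_homog k i a b :
  homogz (fshift (f := linear_seq K k) (i := i.+1) a - fshift (f := linear_seq K k) (i := i) b)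
    (linear_diff K k i a b).
Proof.
have -> : fshift (f := linear_seq K k) (i := i.+1) a -
    fshift (f := linear_seq K k) (i := i) b = 1%N by rewrite /=; lia.
exact: linear_diff_homog.
Qed.

Lemma ideal_resolution k :
  is_minimal_resolution (linear_seq K k) (ideal_module (hideal_exp I k.+3)).
Proof.
split; last exact: linear_seq_minimal.
split; [exact: linear_seq_homog | exact: linear_diff_exact |].
exists (@ideal_augment k.+3); split.
- move=> a; rewrite /= /ideal_piece /= -rowE mxE addn0.
  exact: augment_mx_homog.
- move=> [p hp]; have /hideal_expP/augment_mx_image[w ew] := hp.
  exists w; apply: val_inj; rewrite /= -ew mxE mulr1n //.
- move=> v; rewrite -augment_exact -augment_mx_eq0.
  by split=> [/(congr1 val)|h] //; apply: val_inj.
Qed.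

(** The resolution of I^s moved up one place, with R in front and the augmentation matrix as first
    differential. *)
Definition quotient_seq k : freeSeq K 4 :=
  FreeSeq (frank := fun i => if i is j.+1 then linear_rank k j else 1)
    (fun i => match i return 'I_(if i is j.+1 then linear_rank k j else 1) -> int with
       | 0 => fun _ => 0 | j.+1 => fun _ => (3 * k.+3 + j)%:Z end)
    (fun i => match i return 'M_(linear_rank k i, if i is j.+1 then linear_rank k j else 1) with
       | 0 => augment_mx (@yvar K 4) k.+3 | j.+1 => linear_diff K k j end).

Definition quotient_augment (J : homogIdeal K 4) (v : 'rV[S]_1) : quotient_module J :=
  to_quot J (v 0 0).

Fact quotient_augment_linear J : linear (@quotient_augment J).
Proof. by move=> c u v; rewrite /quotient_augment !mxE linearP. Qed.

HB.instance Definition _ J := GRing.isLinear.Build S _ _ _ (@quotient_augment J)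
  (@quotient_augment_linear J).

Lemma quotient_augment_eq0 J v : quotient_augment J v = 0 <-> v 0 0 \in J.
Proof.
by split=> [/eqP|h]; [|apply/eqP]; rewrite /quotient_augment to_quot_eq0.
Qed.

Lemma quotient_resolution k :
  is_minimal_resolution (quotient_seq k) (quotient_module (hideal_exp I k.+3)).
Proof.
split; last first.
  case=> [|i] a b; last exact: (@linear_seq_minimal K k i a b).
  by apply: (dhomog_nemf_coeff (augment_mx_homog a b)); rewrite /= mdeg0.
split.
- case=> [|i] a b; last exact: linear_seq_homog.
  by rewrite /= !addn0; exact: augment_mx_homog.
- case=> [|i] v; [exact: augment_exact | exact: linear_diff_exact].
exists (@quotient_augment (hideal_exp I k.+3)); split.
- move=> a; rewrite /= /quot_piece; exists 1; first exact: dhomog1.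
  by rewrite /quotient_augment mxE (ord1 a) !eqxx.
- move=> x; have [p ->] := to_quotP x; exists p%:M.
  by rewrite /= /quotient_augment mxE mulr1n.
- move=> v; apply: (iff_trans (quotient_augment_eq0 _ _)).
  apply: (iff_trans (hideal_expP _ _)); apply: (iff_trans (iff_sym (augment_mx_image _ _ _))).
  have -> // : (v 0 0)%:M = v by apply/rowP => j; rewrite ord1 mxE mulr1n.
Qed.

Lemma quotient_resolution_terms k (F : freeSeq K 4) :
  is_minimal_resolution F (quotient_module (hideal_exp I k.+3)) ->
  [/\ free_term F 0 1 0,
      free_term F 1 'C(k.+3 + 3, 3) (3 * k.+3)%N,
      free_term F 2 (3 * 'C(k.+3 + 2, 3)) (3 * k.+3 + 1)%N,
      free_term F 3 (3 * 'C(k.+3 + 1, 3)) (3 * k.+3 + 2)%N &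
      free_term F 4 'C(k.+3, 3) (3 * k.+3 + 3)%N /\
      forall i, (5 <= i)%N -> frank F i = 0%N].
Proof.
move=> hF; have U i := minimal_resolution_unique i hF (quotient_resolution k).
have T i b a : frank (quotient_seq k) i = b ->
    (forall t, fshift (f := quotient_seq k) (i := i) t = a) -> free_term F i b a.
  move=> <- ha; split; first exact: (U i).1.
  by move=> t; have [t' ->] := (U i).2 t; exact: ha.
split; first exact: T.
- by apply: T => [|t] /=; rewrite ?mul1n ?size_dmonos ?addn0.
- by apply: T => [|t] //=; rewrite size_dmonos; congr (_ * 'C(_, _))%N; lia.
- by apply: T => [|t] //=; rewrite size_dmonos; congr (_ * 'C(_, _))%N; lia.
split; last by move=> [|[|[|[|[|i]]]]] // _; exact: (U _).1.
by apply: T => [|t] //=; rewrite mul1n size_dmonos; congr 'C(_, _); lia.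
Qed.

(** All generators in homological degree [i] have degree 3s + i. The value 3s is attained in
    homological degree 0, which has a generator since the binomial coefficient is positive. *)
Lemma ideal_regularity k :
  has_regularity (ideal_module (hideal_exp I k.+3)) (3 * k.+3)%N.
Proof.
have G := ideal_resolution k; split; last first.
  by move=> i j /(tor_neq0_shift G)[b <-] /=; lia.
have a : 'I_(frank (linear_seq K k) 0).
  by apply: (@Ordinal _ 0); rewrite /= mul1n size_dmonos bin_gt0; lia.
exists 0%N, (3 * k.+3)%N%:Z; split; last by rewrite subr0.
by have := minimal_tor_neq0 a G; rewrite /= addn0.
Qed.

End MinimalResolutions.

(** * Hilbert series *)

Section MonomialBasis.
Variable K : fieldType.
Local Notation S := {mpoly K[4]}.
Local Notation A := {mpoly S[4]}.
Local Notation I := (squarefree3_ideal K).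

(** Membership of x^m in I^s: the image of some T^k of degree [s] divides x^m, that is,
    [k j >= s - m j] for all [j]. Such a [k] exists exactly when these lower bounds sum to at most
    [s]. *)
Definition power_monomial s (m : 'X_{1..4}) : bool := (\sum_j (s - m j) <= s)%N.

Lemma sum_ord4 (F : 'I_4 -> nat) :
  (\sum_j F j = F (inord 0) + F (inord 1) + F (inord 2) + F (inord 3))%N.
Proof.
rewrite !big_ord_recl big_ord0 addn0 !addnA.
by congr (F _ + F _ + F _ + F _)%N; apply: val_inj; rewrite /= inordK.
Qed.

Lemma mdeg4 (m : 'X_{1..4}) :
  mdeg m = (m (inord 0) + m (inord 1) + m (inord 2) + m (inord 3))%N.
Proof. by rewrite mdegE sum_ord4. Qed.

Lemma mnm4P (m k : 'X_{1..4}) : m (inord 0) = k (inord 0) -> m (inord 1) = k (inord 1) ->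
  m (inord 2) = k (inord 2) -> m (inord 3) = k (inord 3) -> m = k.
Proof. by move=> h0 h1 h2 h3; apply/mnmP; exact: ord4P. Qed.

Definition mnm4 a b c d : 'X_{1..4} := [multinom nth 0%N [:: a; b; c; d] i | i < 4].

Lemma mnm4E a b c d : (mnm4 a b c d (inord 0) = a) * (mnm4 a b c d (inord 1) = b) *
  (mnm4 a b c d (inord 2) = c) * (mnm4 a b c d (inord 3) = d).
Proof. by rewrite !mnmE !inordK. Qed.

Lemma hideal_exp_msupp s (p : S) :
  p \in hideal_exp I s <-> forall m, p@_m != 0 -> power_monomial s m.
Proof.
split.
  move=> /hideal_expP[q hq ->] m.
  rewrite [q]mpolyE big_seq (raddf_sum (meval (@yvar K 4))) (raddf_sum (mcoeff m)) /= => nz.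
  have [k [kq nk]] : exists k, k \in msupp q /\ (q@_k *: 'X_[k]).@[@yvar K 4]@_m != 0.
    apply: contrapT => H; move/eqP: nz; apply; apply: big1 => k kq.
    by apply/eqP/negPn/negP => nk; apply: H; exists k.
  have := dhomog_mf hq kq; move: nk; rewrite mevalZ yvar_monomial => nk dk.
  have : m \in msupp (q@_k * 'X_[[multinom mdeg k - k j | j < 4]]) by rewrite mcoeff_msupp.
  move=> /msuppM_le/allpairsP[[m1 m2] /= [_]].
  rewrite msuppX inE => /eqP -> ->; rewrite /power_monomial.
  have <- : mdeg k = s := dk.
  rewrite [leqRHS]mdegE; apply: leq_sum => j _; rewrite mnmDE mnmE.
  have : (k j <= mdeg k)%N by rewrite mdegE (bigD1 j) //= leq_addr.
  lia.
move=> H; rewrite [p]mpolyE big_seq.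
apply: (rpred_sum (S := hideal_exp I s)) => m; rewrite mcoeff_msupp => /H hm.
(* The lower bounds in the first three places, and all of the remaining degree in the last. *)
pose k := mnm4 (s - m (inord 0)) (s - m (inord 1)) (s - m (inord 2))
  (s - ((s - m (inord 0)) + (s - m (inord 1)) + (s - m (inord 2)))).
rewrite /power_monomial sum_ord4 in hm.
have dk : mdeg k = s by rewrite mdeg4 !mnm4E; lia.
pose t : 'X_{1..4} := [multinom s - k j | j < 4].
have -> : m = (m - t + t)%MM.
  rewrite submK //; apply/mnm_lepP; elim/ord4P; rewrite mnmE !mnm4E; lia.
rewrite mpolyXD scalerAl; apply: (@rpredZ _ _ (hideal_exp I s)).
apply/hideal_expP; exists 'X_[k]; first by rewrite dhomogX; apply/eqP.
by rewrite yvar_monomial dk.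
Qed.

Definition standard_monos s d := [seq m <- dmonos 4 d | ~~ power_monomial s m].

(** Since I^s is a monomial ideal, the classes of the monomials of degree [d] outside it form a
    basis; coordinates are read off as coefficients. *)
Lemma quotient_has_dim (s d : nat) :
  has_dim (gm_piece (g := quotient_module (hideal_exp I s)) d) (size (standard_monos s d)).
Proof.
set J := hideal_exp I s; set L := standard_monos s d.
have uL : uniq L by rewrite filter_uniq ?dmonos_uniq.
pose x (k : 'I_(size L)) : S := 'X_[nth 0%MM L k].
have xL (k : 'I_(size L)) : nth 0%MM L k \in L by rewrite mem_nth.
have coefx (c : 'rV[K]_(size L)) (k : 'I_(size L)) :
    (\sum_i c 0 i *: x i)@_(nth 0%MM L k) = c 0 k.
  rewrite raddf_sum (bigD1 k) //= mcoeffZ mcoeffX eqxx mulr1 big1 ?addr0 // => i ne.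
  by rewrite mcoeffZ mcoeffX nth_uniq // -[_ == _]/(i == k) (negPf ne) mulr0.
have quotx (c : 'rV[K]_(size L)) :
    \sum_k (c 0 k)%:MP *: to_quot J (x k) = to_quot J (\sum_k c 0 k *: x k).
  rewrite raddf_sum; apply: eq_bigr => k _ /=.
  by rewrite -linearZ; congr to_quot; exact: mul_mpolyC.
exists (fun k => to_quot J (x k)); split.
  move=> k; exists (x k) => //=; rewrite dhomogX; have := xL k.
  by rewrite mem_filter mem_dmonos => /andP[].
move=> _ [p hp ->].
pose c : 'rV[K]_(size L) := \row_k p@_(nth 0%MM L k).
exists c; split.
  rewrite quotx; apply/eqP; rewrite to_quot_eq; apply/hideal_exp_msupp => m.
  rewrite mcoeffB => nz; apply/negPn/negP => nm.
  have [md|md] := eqVneq (mdeg m) d; last first.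
    move: nz; rewrite (dhomog_nemf_coeff hp md) raddf_sum big1 ?subrr ?eqxx // => k _ /=.
    rewrite mcoeffZ mcoeffX; case: eqP => [e|]; last by rewrite mulr0.
    by have := xL k; rewrite mem_filter mem_dmonos e (negPf md) andbF.
  have mL : m \in L by rewrite mem_filter nm mem_dmonos md eqxx.
  have iL : (index m L < size L)%N by rewrite index_mem.
  have := coefx c (Ordinal iL); rewrite /= nth_index // mxE /= nth_index // => e.
  by move: nz; rewrite e subrr eqxx.
move=> c'; rewrite quotx => /eqP; rewrite to_quot_eq => /hideal_exp_msupp h.
apply/rowP => k; rewrite mxE -(coefx c' k); apply/eqP; rewrite -subr_eq0 -mcoeffB.
apply/negPn/negP => /h; have := xL k.
by rewrite mem_filter => /andP[/negPf->].
Qed.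

End MonomialBasis.

(** * Counting the monomials of I^s *)

Section Counting.

Local Notation pairs a b := [seq (m, k) | m <- dmonos 4 a, k <- dmonos 4 b].

Definition disjoint_below r (p : 'X_{1..4} * 'X_{1..4}) : bool :=
  [forall i : 'I_4, (i < r)%N ==> ((p.1 i == 0) || (p.2 i == 0))%N].

Lemma disjoint_belowS r p : (r < 4)%N -> disjoint_below r.+1 p =
  disjoint_below r p && ((p.1 (inord r) == 0) || (p.2 (inord r) == 0))%N.
Proof.
move=> hr; apply/forallP/andP => [h|[/forallP h hp] i].
  split; last by have := h (inord r); rewrite inordK // ltnSn.
  by apply/forallP => i; apply/implyP => ir; apply: (implyP (h i)); exact: leqW.
apply/implyP; rewrite ltnS leq_eqVlt => /orP[/eqP ir|]; last exact: (implyP (h i)).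
by rewrite -[i]inord_val ir.
Qed.

Lemma mem_pairs a b (m k : 'X_{1..4}) :
  ((m, k) \in pairs a b) = (mdeg m == a) && (mdeg k == b).
Proof.
apply/allpairsP/andP => [[[m' k'] /= [hm hk [-> ->]]]|[hm hk]].
  by rewrite !mem_dmonos in hm hk.
by exists (m, k); rewrite !mem_dmonos.
Qed.

Lemma pairs_uniq a b : uniq (pairs a b).
Proof. by apply: allpairs_uniq; rewrite ?dmonos_uniq // => -[? ?] [? ?]. Qed.

(** The pairs excluded by the new condition are those divisible by x_r T_r. Division by it is a
    bijection onto the pairs counted last, as [disjoint_below r] does not involve the index [r]. *)
Lemma count_disjoint_belowS r a b : (r < 4)%N ->
  count (disjoint_below r) (pairs a.+1 b.+1) =
  (count (disjoint_below r.+1) (pairs a.+1 b.+1) +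
   count (disjoint_below r) (pairs a b))%N.
Proof.
move=> hr; set T := pairs _ _.
pose Z (p : 'X_{1..4} * 'X_{1..4}) := ((p.1 (inord r) == 0) || (p.2 (inord r) == 0))%N.
have -> : count (disjoint_below r) T =
    (count (disjoint_below r.+1) T + count (fun p => disjoint_below r p && ~~ Z p) T)%N.
  elim: T => //= p t ->; rewrite disjoint_belowS // -/(Z p).
  by case: disjoint_below; case: (Z p) => /=; lia.
congr (_ + _)%N; pose u : 'X_{1..4} := U_(inord r)%MM.
rewrite -!size_filter -[RHS](size_map (fun p => ((p.1 + u)%MM, (p.2 + u)%MM))).
apply: perm_size; apply: uniq_perm.
- by rewrite filter_uniq ?pairs_uniq.
- rewrite map_inj_uniq ?filter_uniq ?pairs_uniq //.
  apply: (can_inj (g := fun p => ((p.1 - u)%MM, (p.2 - u)%MM))) => -[m k] /=.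
  by rewrite !addmK.
have dB (m k : 'X_{1..4}) :
    disjoint_below r ((m + u)%MM, (k + u)%MM) = disjoint_below r (m, k).
  apply: eq_forallb => i /=; case: ltnP => //= ir.
  have ne : (inord r == i) = false.
    by apply/eqP => e; move: ir; rewrite -e inordK // ltnn.
  by rewrite !mnmDE !mnm1E ne !addn0.
move=> [m k]; apply/idP/mapP.
  rewrite mem_filter mem_pairs /Z /= negb_or -!andbA => /and5P[d m0 k0 /eqP dm /eqP dk].
  have em : (m - u + u)%MM = m by rewrite submK // lep1mP.
  have ek : (k - u + u)%MM = k by rewrite submK // lep1mP.
  exists ((m - u)%MM, (k - u)%MM); last by rewrite /= em ek.
  rewrite mem_filter mem_pairs -dB em ek d /=.
  by rewrite -(eqn_add2r (mdeg u)) -[X in _ && X](eqn_add2r (mdeg u)) -!mdegD em ek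
    mdeg1 dm dk !addn1 !eqxx.
move=> [[m' k'] + [-> ->]] /=; rewrite !mem_filter !mem_pairs => /andP[d /andP[/eqP dm /eqP dk]].
rewrite dB d /= /Z /= !mnmDE !mnm1E eqxx !addn1 /=.
by rewrite !mdegD !mdeg1 dm dk !addn1 !eqxx.
Qed.

Lemma count_disjoint_below0 r a b : (r < 4)%N -> (a == 0) || (b == 0) ->
  count (disjoint_below r.+1) (pairs a b) = count (disjoint_below r) (pairs a b).
Proof.
move=> hr ab0; apply: eq_in_count => -[m k]; rewrite mem_pairs disjoint_belowS //=.
move=> /andP[/eqP dm /eqP dk]; suff -> : (m (inord r) == 0) || (k (inord r) == 0).
  by rewrite andbT.
rewrite -dm -dk !mdeg_eq0 in ab0.
by case/orP: ab0 => /eqP->; rewrite mnm0E ?orbT.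
Qed.

Local Notation g i a b := ('C(a + i, 3) * 'C(b + i, 3))%N.

(** Each of the three forbidden products has bidegree (1, 1), so the count is a third difference
    along the diagonal, arranged to avoid subtraction. [g i a b] counts the pairs of degrees a + i -
    3 and b + i - 3 and is 0 if one of them is negative, which covers the boundary cases. *)
Lemma count_disjoint a b :
  (count (disjoint_below 3) (pairs a b) + 3 * g 2 a b + g 0 a b =
   g 3 a b + 3 * g 1 a b)%N.
Proof.
have c0 a' b' : count (disjoint_below 0) (pairs a' b') = g 3 a' b'.
  rewrite -[RHS](_ : size (pairs a' b') = _); last by rewrite size_allpairs !size_dmonos.
  by rewrite -count_predT; apply: eq_count => p; apply/forallP.
have c1 a' b' : (count (disjoint_below 1) (pairs a' b') + g 2 a' b' = g 3 a' b')%N.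
  case: a' => [|a']; first by rewrite count_disjoint_below0 // c0 addn0.
  case: b' => [|b']; first by rewrite count_disjoint_below0 // c0 muln0 addn0.
  by rewrite -[RHS]c0 (@count_disjoint_belowS 0) // c0 !addnS !addSn.
have c2 a' b' : (count (disjoint_below 2) (pairs a' b') + 2 * g 2 a' b' =
    g 3 a' b' + g 1 a' b')%N.
  have := c1 a' b'.
  case: a' => [|a']; first by rewrite (@count_disjoint_below0 1) // !mul0n; lia.
  case: b' => [|b']; first by rewrite (@count_disjoint_below0 1) // !muln0; lia.
  have := c1 a' b'; have := @count_disjoint_belowS 1 a' b' isT.
  rewrite !addnS !addSn; lia.
have := c2 a b.
case: a => [|a]; first by rewrite (@count_disjoint_below0 2) // !mul0n; lia.
case: b => [|b]; first by rewrite (@count_disjoint_below0 2) // !muln0; lia.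
have := c2 a b; have := @count_disjoint_belowS 2 a b isT.
rewrite !addnS !addSn; lia.
Qed.

(* [f (m, k)] is the exponent of the image of [x^m T^k] in [R], and [h] recovers the
   normal form [x^m T^k] from it. *)
Lemma count_power_monomial s a :
  count (power_monomial s) (dmonos 4 (3 * s + a)) =
  count (disjoint_below 3) (pairs a s).
Proof.
pose f (p : 'X_{1..4} * 'X_{1..4}) : 'X_{1..4} := (p.1 + [multinom s - p.2 j | j < 4])%MM.
pose b (m : 'X_{1..4}) :=
  (s - ((s - m (inord 0)) + (s - m (inord 1)) + (s - m (inord 2))))%N.
pose h (m : 'X_{1..4}) := (mnm4 (m (inord 0) - s) (m (inord 1) - s) (m (inord 2) - s)
    (m (inord 3) + b m - s),
  mnm4 (s - m (inord 0)) (s - m (inord 1)) (s - m (inord 2)) (b m)).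
have disj m k : disjoint_below 3 (m, k) = [&& (m (inord 0) == 0) || (k (inord 0) == 0),
    (m (inord 1) == 0) || (k (inord 1) == 0) & (m (inord 2) == 0) || (k (inord 2) == 0)]%N.
  rewrite !disjoint_belowS // [disjoint_below 0 _](_ : _ = true) ?andbA //.
  exact/forallP.
have hK : {in filter (disjoint_below 3) (pairs a s), cancel f h}.
  move=> [m k]; rewrite mem_filter mem_pairs disj !mdeg4 => H.
  rewrite /h /f /b /=; congr pair; apply: mnm4P; rewrite !mnm4E !mnmDE !mnmE; lia.
rewrite -!size_filter -[RHS](size_map f); apply: perm_size; apply: uniq_perm.
- by rewrite filter_uniq ?dmonos_uniq.
- by rewrite map_inj_in_uniq ?filter_uniq ?pairs_uniq //; exact: can_in_inj hK.
move=> m; apply/idP/mapP.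
  rewrite mem_filter mem_dmonos /power_monomial sum_ord4 mdeg4 => H.
  exists (h m); last first.
    by apply: mnm4P; rewrite mnmDE mnmE !mnm4E /b; lia.
  by rewrite mem_filter mem_pairs disj !mdeg4 !mnm4E /b; lia.
move=> [[m' k] + ->]; rewrite !mem_filter mem_pairs mem_dmonos disj /power_monomial.
rewrite sum_ord4 !mdeg4 /f !mnmDE !mnmE /=; lia.
Qed.

Lemma no_power_monomial s d : (d < 3 * s)%N ->
  count (power_monomial s) (dmonos 4 d) = 0%N.
Proof.
move=> hd; apply/eqP; rewrite -leqn0 leqNgt -has_count; apply/hasP => -[m].
rewrite mem_dmonos /power_monomial sum_ord4 mdeg4; lia.
Qed.

Lemma size_standard_monos s d :
  (size (standard_monos s d) + count (power_monomial s) (dmonos 4 d) = 'C(d + 3, 3))%N.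
Proof.
rewrite /standard_monos size_filter addnC -[RHS]size_dmonos.
exact: (count_predC (power_monomial s)).
Qed.

End Counting.

(** * From the count to the rational function *)

Section HilbertSeries.

Definition hilbert_numerator s : {poly int} :=
  \sum_(0 <= i < 3 * s) (i + 1)%:R *: 'X^i
    + ((3 * s)%:R + 1 - 'C(s + 3, 3)%:R) *: 'X^(3 * s) + 'C(s, 3)%:R *: 'X^(3 * s + 1).

Lemma coef_hilbert_numerator s m : (hilbert_numerator s)`_m =
  (if (m < 3 * s)%N then (m%:Z + 1) else 0)
  + (if m == (3 * s)%N then (3 * s)%:Z + 1 - 'C(s + 3, 3)%:Z else 0)
  + (if m == (3 * s + 1)%N then 'C(s, 3)%:Z else 0).
Proof.
rewrite /hilbert_numerator big_mkord -(poly_def (3 * s) (fun i => (i + 1)%:R)).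
rewrite !coefD !coefZ !coefXn coef_poly.
by do 3 case: ifP => _ //; rewrite ?mulr1 ?mulr0 ?PoszD ?natz.
Qed.

Lemma hilbert_numeratorE s :
  \sum_(1 <= i < (3 * s).+1) i%:R *: 'X^(i.-1)
    - ('C(s + 3, 3)%:R - (3 * s)%:R - 1) *: 'X^(3 * s) + 'C(s, 3)%:R *: 'X^(3 * s + 1)
  = hilbert_numerator s.
Proof.
rewrite /hilbert_numerator big_add1 /=; congr (_ + _ + _).
  by apply: eq_bigr => i _; rewrite addn1.
rewrite -scaleNr; congr (_ *: _); ring.
Qed.

(** Multiplication by (1 - t)^2 is the second difference, with 0 in negative degrees. *)
Lemma pseries_mul_sqr (H : pseries) m :
  pseries_mul H (pseries_of_poly ((1 - 'X) ^+ 2)) m =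
  H m - (if m is m'.+1 then 2 * H m' else 0) + (if m is m'.+2 then H m' else 0).
Proof.
have c k : ((1 - 'X : {poly int}) ^+ 2)`_k = (k == 0)%:R - 2 * (k == 1)%:R + (k == 2)%:R.
  have -> : (1 - 'X : {poly int}) ^+ 2 = 1%:P - 2%:P * 'X + 'X^2.
    by rewrite polyC1 polyCMn; ring.
  by rewrite coefD coefB coefC coefCM coefX coefXn; case: k.
rewrite /pseries_mul /pseries_of_poly; under eq_bigr do rewrite c.
case: m => [|[|m]].
- by rewrite big_ord_recr big_ord0 /=; ring.
- by rewrite !big_ord_recr big_ord0 /=; ring.
rewrite !big_ord_recr /= big1 => [|i _]; last first.
  have h : (m.+2 - i > 2)%N by have := ltn_ord i; lia.
  by move: h; case: (m.+2 - i)%N => [|[|[|k]]] //= _; rewrite mulr0.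
have e0 : (m.+2 - m.+2 = 0)%N by lia.
have e1 : (m.+2 - m.+1 = 1)%N by lia.
have e2 : (m.+2 - m = 2)%N by lia.
by rewrite e0 e1 e2 /=; ring.
Qed.

Definition quotient_hilbert s m : int := (size (standard_monos s m))%:Z.

Lemma quotient_hilbert_lt s m : (m < 3 * s)%N ->
  quotient_hilbert s m = 'C(m + 3, 3)%:Z.
Proof.
by move=> hm; rewrite -(size_standard_monos s m) (no_power_monomial hm) addn0.
Qed.

Lemma quotient_hilbert_ge s a : quotient_hilbert s (3 * s + a) =
  'C(3 * s + a + 3, 3)%:Z - 'C(a + 3, 3)%:Z * 'C(s + 3, 3)%:Z
  + 3 * 'C(a + 2, 3)%:Z * 'C(s + 2, 3)%:Z
  - 3 * 'C(a + 1, 3)%:Z * 'C(s + 1, 3)%:Z + 'C(a, 3)%:Z * 'C(s, 3)%:Z.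
Proof.
have := size_standard_monos s (3 * s + a); have := count_disjoint a s.
rewrite count_power_monomial !addn0 /quotient_hilbert -!PoszM; lia.
Qed.

(** Reduces all shifts to the atoms C(n, 3), C(n, 2) and n, so that [lia] and [ring] can
    conclude. *)
Lemma bin3_shift n : [/\ 'C(n + 1, 3)%:Z = 'C(n, 3)%:Z + 'C(n, 2)%:Z,
  'C(n + 2, 3)%:Z = 'C(n, 3)%:Z + 2 * 'C(n, 2)%:Z + n%:Z
  & 'C(n + 3, 3)%:Z = 'C(n, 3)%:Z + 3 * 'C(n, 2)%:Z + 3 * n%:Z + 1].
Proof. by rewrite addn3 addn2 addn1 !binS !bin0 bin1; split; lia. Qed.

Lemma bin3_diff2 n : ('C(n + 3, 3)%:Z - 2 * 'C(n + 2, 3)%:Z + 'C(n + 1, 3)%:Z = n%:Z + 1).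
Proof. by rewrite addnS addn2 addn1 !binS !bin0 bin1; lia. Qed.

(** Below degree 3s the quotient agrees with R, and the second difference of C(m + 3, 3) is m + 1.
    From 3s + 2 on the second difference is 0. Only at 3s and 3s + 1 do both ranges meet, which
    produces the two exceptional coefficients. *)
Lemma quotient_hilbert_frac s : (3 <= s)%N ->
  pseries_eq_frac (quotient_hilbert s) (hilbert_numerator s) ((1 - 'X) ^+ 2).
Proof.
move=> hs m; rewrite pseries_mul_sqr /pseries_of_poly coef_hilbert_numerator.
have [e1 e2 e3] := bin3_shift s.
have [lt|ge] := ltnP m (3 * s).
  rewrite !ltn_eqF //; last lia.
  case: m lt => [|[|m]] lt; rewrite !quotient_hilbert_lt //; try lia.
  have := bin3_diff2 m.+2; rewrite !addSn !addnS; lia.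
have hge := quotient_hilbert_ge s.
have [c0 c1 c2 c4] : [/\ 'C(0, 3) = 0, 'C(1, 3) = 0, 'C(2, 3) = 0 & 'C(4, 3) = 4]%N by [].
have h0 : quotient_hilbert s (3 * s) = 'C(3 * s + 3, 3)%:Z - 'C(s + 3, 3)%:Z.
  by rewrite -[X in quotient_hilbert _ X]addn0 hge addn0 !add0n c0 c1 c2 binn; lia.
have h1 : quotient_hilbert s (3 * s + 1) =
    'C(3 * s + 1 + 3, 3)%:Z - 4 * 'C(s + 3, 3)%:Z + 3 * 'C(s + 2, 3)%:Z.
  by rewrite hge !add1n c4 c2 c1 binn; lia.
have [p ep] : exists p, m = p.+2 by exists m.-2; lia.
rewrite ep; have d2 := bin3_diff2 p.+2.
have [em|[em|[a em]]] : m = (3 * s)%N \/ m = (3 * s + 1)%N \/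
    exists a, m = (3 * s + a.+2)%N.
  have [d ->] : exists d, m = (3 * s + d)%N by exists (m - 3 * s)%N; lia.
  case: d => [|[|a]]; [left; lia | right; left; lia | right; right; by exists a].
- have -> : (p.+2 == 3 * s)%N by lia.
  have -> : (p.+2 == 3 * s + 1)%N = false by lia.
  rewrite -ep em h0 -em ep !quotient_hilbert_lt; try lia.
  by move: d2; rewrite !addSn !addnS !addn0; lia.
- have -> : (p.+2 == 3 * s)%N = false by lia.
  have -> : (p.+2 == 3 * s + 1)%N by lia.
  have e' : p.+1 = (3 * s)%N by lia.
  rewrite -ep em h1 -em ep e' h0 -e' quotient_hilbert_lt; last lia.
  rewrite e2 e3.
  by move: d2; rewrite !addSn !addnS !addn0; lia.
(* All three values are now at least 3s. The second differences are linear in [a]: the coefficient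
   of [a] cancels because the third difference of C(n, 3) is 1, and the constant term because its
   second difference at [s] is s + 1. *)
have -> : (p.+2 == 3 * s)%N = false by lia.
have -> : (p.+2 == 3 * s + 1)%N = false by lia.
have e0 : p = (3 * s + a)%N by lia.
have {}d2 : 'C(3 * s + a.+2 + 3, 3)%:Z - 2 * 'C(3 * s + a.+1 + 3, 3)%:Z +
    'C(3 * s + a + 3, 3)%:Z = (3 * s + a.+2)%:Z + 1.
  by move: d2; rewrite e0 !addSn !addnS !addn0.
have d n := bin3_diff2 n; have [f1 f2 f3] := bin3_shift a.
have f4 : 'C(a + 4, 3)%:Z = 2 * 'C(a + 3, 3)%:Z - 'C(a + 2, 3)%:Z + a%:Z + 2.
  by have := d a.+1; rewrite !addSn !addnS; lia.
have f5 : 'C(a + 5, 3)%:Z = 2 * 'C(a + 4, 3)%:Z - 'C(a + 3, 3)%:Z + a%:Z + 3.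
  by have := d a.+2; rewrite !addSn !addnS; lia.
rewrite e0 -!addnS !hge.
have g3 : 'C(3 * s + a.+2 + 3, 3)%:Z = 2 * 'C(3 * s + a.+1 + 3, 3)%:Z -
    'C(3 * s + a + 3, 3)%:Z + 3 * s%:Z + a%:Z + 3 by lia.
have -> : (a.+2 + 3 = a + 5)%N by lia.
have -> : (a.+2 + 2 = a + 4)%N by lia.
have -> : (a.+1 + 3 = a + 4)%N by lia.
have -> : (a.+2 + 1 = a + 3)%N by lia.
have -> : (a.+1 + 2 = a + 3)%N by lia.
have -> : (a.+1 + 1 = a + 2)%N by lia.
rewrite -(addn2 a) -(addn1 a) in g3 *.
by rewrite g3 f5 f4 f3 f2 f1 e3 e2 e1; ring.
Qed.

End HilbertSeries.

Theorem theorem4p7 (K : fieldType) (s : nat) (hs : (3 <= s)%N) :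
  let RIs := quotient_module (hideal_exp (squarefree3_ideal K) s) in
  let Is := ideal_module (hideal_exp (squarefree3_ideal K) s) in
  [/\ exists F : freeSeq K 4, is_minimal_resolution F RIs,
      forall F : freeSeq K 4, is_minimal_resolution F RIs ->
        [/\ free_term F 0 1 0,
            free_term F 1 'C(s + 3, 3) (3 * s)%N,
            free_term F 2 (3 * 'C(s + 2, 3)) (3 * s + 1)%N,
            free_term F 3 (3 * 'C(s + 1, 3)) (3 * s + 2)%N &
            free_term F 4 'C(s, 3) (3 * s + 3)%N /\
            forall i, (5 <= i)%N -> frank F i = 0%N],
      has_regularity Is (3 * s)%N
    & exists2 H : pseries, is_hilbert_series RIs H &
        pseries_eq_frac H
          (\sum_(1 <= i < (3 * s).+1) i%:R *: 'X^(i.-1)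
           - ('C(s + 3, 3)%:R - (3 * s)%:R - 1) *: 'X^(3 * s)
           + 'C(s, 3)%:R *: 'X^(3 * s + 1))
          ((1 - 'X) ^+ 2) /\
        pseries_eq_frac H
          (\sum_(0 <= i < 3 * s) (i + 1)%:R *: 'X^i
           + ((3 * s)%:R + 1 - 'C(s + 3, 3)%:R) *: 'X^(3 * s)
           + 'C(s, 3)%:R *: 'X^(3 * s + 1))
          ((1 - 'X) ^+ 2)].
Proof.
move=> RIs Is; split.
- case: s hs @RIs @Is => [|[|[|k]]] // _ RIs _.
  by exists (quotient_seq K k); exact: quotient_resolution.
- by case: s hs @RIs @Is => [|[|[|k]]] // _ RIs _; exact: quotient_resolution_terms.
- by case: s hs @RIs @Is => [|[|[|k]]] // _ _ Is; exact: ideal_regularity.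
exists (quotient_hilbert s); last first.
  by split; [rewrite hilbert_numeratorE|]; exact: quotient_hilbert_frac.
(* In negative degrees the only homogeneous representative is 0. *)
split=> [[d|d] x // _ [p /eqP -> ->]|d]; first exact: raddf0.
by exists (size (standard_monos s d)); first exact: quotient_has_dim.
Qed.
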